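(* Let $p\in\mathbb{N}$ and suppose $f\in A_p$ is reversible in $G$ but not flowable. Let $d,q,\delta$ and $\omega$ be as described in the context. Then: (1) If $g\in R_f(G)$, then $g$ commutes with $\omega$, and $g$ reverses $f^{r/d}$ for each $r\in\mathbb{Z}$. (2) $\delta=q$, and $p/q$ is odd. (3) If $\omega$ is chosen with $m(\omega)=e^{2\pi i/\delta}$, then $\{g^2: g\in R_f(G)\}=\{\omega^l: l \text{ odd}\}$; and (for any choice of generator $\omega$) the set of orders of reversers is $\{\mathrm{ord}(g): g\in R_f(G)\}=\{2r: r\in\mathbb{N},\ r\mid q,\ q/r \text{ odd}\}$.
   Context: $G$ denotes the group (under composition) of biholomorphic germs at $0$ in one complex variable: germs of functions holomorphic near $0$ with $f(0)=0$ and $f'(0)\neq 0$; $m(f)=f'(0)$ is the multiplier. $G_1=\{f\in G: f'(0)=1\}$, and for $p\in\mathbb{N}$, $G_p=\{f\in G_1: f^{(k)}(0)=0 \text{ for } 2\le k\le p\}$ and $A_p=G_p\setminus G_{p+1}$. For $f\in G$, $R_f(G)$ is the set of $g\in G$ with $g^{-1}\circ f\circ g=f^{-1}$ ($g$ reverses $f$), $f$ is reversible if $R_f(G)\ne\emptyset$, and $C_f(K)$ denotes the centraliser of $f$ in a subgroup $K$. A flow in $G_1$ is a continuous group homomorphism $t\mapsto f_t$ from $(\mathbb{R},+)$ or $(\mathbb{C},+)$ into $G_1$; $f\in G_1$ is flowable if $f=f_1$ for some flow. For $f\in A_p$ not flowable, it is known that $C_f(G)$ is abelian, $C_f(G_1)$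 is infinite cyclic with a unique generator $f^{1/d}$ satisfying $(f^{1/d})^d=f$ for a positive integer $d$ (and $f^{r/d}$ denotes $(f^{1/d})^r$), $q$ denotes the index of $C_f(G_1)$ in $C_f(G)$ (the quotient is cyclic of order $q$, with $q\mid p$), $\delta$ denotes the order of the torsion subgroup of $C_f(G)$, which is cyclic, and $\omega$ denotes a generator of this torsion subgroup. *)

(* Defs.v *)
From Stdlib Require Import Reals ZArith Arith.
From Coquelicot Require Import Coquelicot.
Open Scope R_scope.

(* Germs at 0 are represented by functions C -> C; two functions represent
   the same germ iff they agree on some disc around 0. *)
Definition germ_eq (f g : C -> C) : Prop :=
  exists r : R, 0 < r /\ forall z : C, Cmod z < r -> f z = g z.

Definition idC : C -> C := fun z => z.
Definition gcomp (f g : C -> C) : C -> C := fun z => f (g z).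
Definition fiter (n : nat) (f : C -> C) : C -> C := Nat.iter n (gcomp f) idC.

Definition holo_near0 (f : C -> C) : Prop :=
  exists r : R, 0 < r /\
    forall z : C, Cmod z < r -> @ex_derive C_AbsRing C_NormedModule f z.

Definition Cderiv_n (k : nat) (f : C -> C) : C -> C := Nat.iter k C_derive f.

Definition multiplier (f : C -> C) : C := C_derive f (RtoC 0).

Definition inG (f : C -> C) : Prop :=
  holo_near0 f /\ f (RtoC 0) = RtoC 0 /\ multiplier f <> RtoC 0.
Definition inG1 (f : C -> C) : Prop := inG f /\ multiplier f = RtoC 1.
Definition inGp (p : nat) (f : C -> C) : Prop :=
  inG1 f /\ forall k : nat, (2 <= k <= p)%nat -> Cderiv_n k f (RtoC 0) = RtoC 0.
Definition inAp (p : nat) (f : C -> C) : Prop := inGp p f /\ ~ inGp (p + 1) f.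

Definition ginv (g g' : C -> C) : Prop :=
  inG g' /\ germ_eq (gcomp g g') idC /\ germ_eq (gcomp g' g) idC.

Definition zpow_rel (f : C -> C) (n : Z) (F : C -> C) : Prop :=
  if Z.leb 0 n then germ_eq F (fiter (Z.to_nat n) f)
  else exists f', ginv f f' /\ germ_eq F (fiter (Z.to_nat (- n)) f').

Definition reverses (g f : C -> C) : Prop :=
  exists g' f', ginv g g' /\ ginv f f' /\ germ_eq (gcomp g' (gcomp f g)) f'.

Definition reverser (f g : C -> C) : Prop := inG g /\ reverses g f.

Definition gcommute (f g : C -> C) : Prop := germ_eq (gcomp f g) (gcomp g f).

Definition centG (f g : C -> C) : Prop := inG g /\ gcommute g f.
Definition centG1 (f g : C -> C) : Prop := inG1 g /\ gcommute g f.

Definition has_order (g : C -> C) (n : nat) : Prop :=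
  (0 < n)%nat /\ germ_eq (fiter n g) idC /\
  forall k : nat, (0 < k < n)%nat -> ~ germ_eq (fiter k g) idC.

Definition is_torsion (g : C -> C) : Prop :=
  exists n : nat, (0 < n)%nat /\ germ_eq (fiter n g) idC.

(* q is the index of the subgroup H in the group K (both given as
   germ-invariant predicates): q distinct left cosets c_i o H cover K. *)
Definition has_index (H K : (C -> C) -> Prop) (q : nat) : Prop :=
  exists c : nat -> (C -> C),
    (forall i, (i < q)%nat -> K (c i)) /\
    (forall i j, (i < q)%nat -> (j < q)%nat ->
       (exists k, H k /\ germ_eq (c j) (gcomp (c i) k)) -> i = j) /\
    (forall x, K x -> exists i, (i < q)%nat /\
       exists k, H k /\ germ_eq x (gcomp (c i) k)).

(* flows in G_1 parametrised by (R,+) or (C,+): group homomorphisms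
   t |-> f_t into G_1 (up to germ equality), continuous for the topology of
   coefficientwise convergence (each Taylor coefficient f_t^{(k)}(0)
   depends continuously on t). *)
Definition is_flow_R (phi : R -> (C -> C)) : Prop :=
  (forall t, inG1 (phi t)) /\
  (forall s t, germ_eq (phi (s + t)) (gcomp (phi s) (phi t))) /\
  (forall (k : nat) (t : R),
     @continuous R_UniformSpace C_UniformSpace
       (fun u => Cderiv_n k (phi u) (RtoC 0)) t).

Definition is_flow_C (phi : C -> (C -> C)) : Prop :=
  (forall t, inG1 (phi t)) /\
  (forall s t, germ_eq (phi (Cplus s t)) (gcomp (phi s) (phi t))) /\
  (forall (k : nat) (t : C),
     @continuous C_UniformSpace C_UniformSpace
       (fun u => Cderiv_n k (phi u) (RtoC 0)) t).

Definition flowable (f : C -> C) : Prop :=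
  inG1 f /\
  ((exists phi, is_flow_R phi /\ germ_eq f (phi 1)) \/
   (exists phi, is_flow_C phi /\ germ_eq f (phi (RtoC 1)))).

(* Main.v *)
Require Import Defs.
From Stdlib Require Import Reals ZArith Arith Lra Lia.
From Stdlib Require Import Classical IndefiniteDescription Setoid Morphisms.
From Coquelicot Require Import Coquelicot.
Open Scope R_scope.

(* Write f(z) = z + a z^(p+1) + o(z^(p+1)) with a <> 0. Comparing coefficients of z^(p+1),
   the multiplier m(x) satisfies m(x)^p = 1 if x commutes with f and m(x)^p = -1 if x
   reverses f; in particular the multipliers of the group of all x that commute with f or
   reverse it form a finite cyclic group, generated by m(g) for some reverser g. The
   generator h = f^(1/d) has infinite order, so conjugation by a reverser inverts it. A
   power of g with multiplier 1 is a power of h that commutes with g and is inverted by g,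
   hence is trivial: g has the same finite order 2N as m(g). So g^2 generates the torsion of
   the centraliser, N = delta = q, and the reversers are the g^l h^c with l odd, whose
   squares are g^(2l).

   That a complex differentiable function has such an expansion rests on Goursat's lemma
   and Cauchy's formula, here for squares. *)

(** * Complex derivatives and integrals *)

(** A germ in [inG] comes without an inverse, and the inverse function theorem is never invoked:
    every inverse is obtained algebraically. Reversers and f carry one in the definition of
    [reverses]; h gets one from h^d = f; a germ k commuting with f gets one from k^p, whose
    multiplier m(k)^p = 1 makes it a power of h. This is why m(k)^p = 1 is derived for bare
    functions, before k is known to be a group element.

    Expansions are exact identities f z = z + z^(p+1) A z with A continuous at 0. Such identities
    can be composed, and coefficients are compared by letting z tend to 0, so no power series occur.
    Complex analysis enters through one fact, that f' is again differentiable near 0: it gives sense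
    to the conditions on higher derivatives, and it makes k' continuous, which the comparison of f o
    k with k o f' requires. The constant 2 pi i of Cauchy's formula matters only as a nonzero number
    to divide by.

    Once m(x)^p is known to be 1 or -1 and f to have infinite order, the argument takes place in an
    abstract group with a homomorphism m to the nonzero complex numbers. *)

Local Notation is_Cderive := (@is_derive C_AbsRing C_NormedModule).
Local Notation ex_Cderive := (@ex_derive C_AbsRing C_NormedModule).
Local Notation Ccont := (@continuous C_UniformSpace C_UniformSpace).
Local Notation CInt := (@RInt C_R_CompleteNormedModule).
Local Notation ex_CInt := (@ex_RInt C_R_NormedModule).
Local Notation is_CInt := (@is_RInt C_R_NormedModule).
Local Notation Rcont := (@continuous R_UniformSpace C_UniformSpace).

Lemma norm_C_R (z : C) : @norm R_AbsRing C_R_NormedModule z = Cmod z.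
Proof.
  change (sqrt (Rabs (fst z) ^ 2 + Rabs (snd z) ^ 2) = Cmod z).
  rewrite !pow2_abs. reflexivity.
Qed.

(** The balls of [C_UniformSpace] are boxes and those of [Cmod] are discs; the compatibility of norm
    and uniform structure makes the two neighbourhood filters equal. *)
Lemma locally_Cmod (z : C) (P : C -> Prop) :
  @locally C_UniformSpace z P <-> exists r, 0 < r /\ forall w, Cmod (w - z) < r -> P w.
Proof.
  split.
  - intros H. apply (@locally_norm_le_locally C_AbsRing C_NormedModule z) in H.
    destruct H as [e He]. exists e. split; [apply cond_pos|]. intros w Hw. apply He. exact Hw.
  - intros (r & Hr & H). apply (@locally_le_locally_norm C_AbsRing C_NormedModule z).
    exists (mkposreal r Hr). intros y Hy. apply H. exact Hy.
Qed.

Lemma Ccont_eps (F : C -> C) (z : C) :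
  Ccont F z <-> forall e, 0 < e -> exists r, 0 < r /\
    forall w, Cmod (w - z) < r -> Cmod (F w - F z) < e.
Proof.
  split.
  - intros H e He.
    assert (L : @locally C_UniformSpace (F z) (fun y => Cmod (y - F z) < e)).
    { apply locally_Cmod. exists e; auto. }
    apply H in L. apply locally_Cmod in L. exact L.
  - intros H P HP. apply locally_Cmod in HP. destruct HP as (e & He & HP).
    destruct (H e He) as (r & Hr & HF). apply locally_Cmod. exists r; split; auto.
Qed.

Lemma is_Cderive_eps (F : C -> C) (z l : C) :
  is_Cderive F z l <-> forall e, 0 < e -> exists r, 0 < r /\
    forall w, Cmod (w - z) < r -> Cmod (F w - F z - (w - z) * l) <= e * Cmod (w - z).
Proof.
  split.
  - intros [_ H] e He.
    specialize (H z (fun P H => H) (mkposreal e He)).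
    apply locally_C, locally_Cmod in H. exact H.
  - intros H. split; [apply (@is_linear_scal_l C_AbsRing C_NormedModule)|].
    intros x Hx e.
    apply (@is_filter_lim_locally_unique C_AbsRing (AbsRing_NormedModule C_AbsRing)) in Hx. subst x.
    apply locally_C, locally_Cmod. apply (H e (cond_pos e)).
Qed.

(** [C] carries two normed module structures over itself. The product rule, and the inner function
    of the chain rule, live in the one built from the ring. *)
Lemma is_Cderive_ring (F : C -> C) (z l : C) :
  is_Cderive F z l <-> @is_derive C_AbsRing (AbsRing_NormedModule C_AbsRing) F z l.
Proof.
  split.
  - intros [_ H]. split; [apply (@is_linear_scal_l C_AbsRing (AbsRing_NormedModule C_AbsRing))|]. exact H.
  - intros [_ H]. split; [apply (@is_linear_scal_l C_AbsRing C_NormedModule)|]. exact H.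
Qed.

Lemma is_Cderive_ext_loc (F G : C -> C) (z l : C) (r : R) :
  0 < r -> (forall w, Cmod (w - z) < r -> F w = G w) -> is_Cderive F z l -> is_Cderive G z l.
Proof.
  intros Hr H. apply is_derive_ext_loc. apply locally_C, locally_Cmod. exists r; auto.
Qed.

Lemma is_Cderive_const (c z : C) : is_Cderive (fun _ => c) z (RtoC 0).
Proof. apply (@is_derive_const C_AbsRing C_NormedModule). Qed.

Lemma is_Cderive_id (z : C) : is_Cderive (fun w => w) z (RtoC 1).
Proof. apply is_Cderive_ring. apply (@is_derive_id C_AbsRing). Qed.

Lemma is_Cderive_plus (F G : C -> C) (z l m : C) :
  is_Cderive F z l -> is_Cderive G z m -> is_Cderive (fun w => F w + G w)%C z (l + m)%C.
Proof. apply (@is_derive_plus C_AbsRing C_NormedModule). Qed.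

Lemma is_Cderive_minus (F G : C -> C) (z l m : C) :
  is_Cderive F z l -> is_Cderive G z m -> is_Cderive (fun w => F w - G w)%C z (l - m)%C.
Proof. apply (@is_derive_minus C_AbsRing C_NormedModule). Qed.

Lemma is_Cderive_mult (F G : C -> C) (z l m : C) :
  is_Cderive F z l -> is_Cderive G z m ->
  is_Cderive (fun w => F w * G w)%C z (l * G z + F z * m)%C.
Proof.
  rewrite !is_Cderive_ring. intros HF HG.
  apply (@is_derive_mult C_AbsRing); auto. intros; apply Cmult_comm.
Qed.

Lemma is_Cderive_comp (F G : C -> C) (z l m : C) :
  is_Cderive F (G z) l -> is_Cderive G z m -> is_Cderive (fun w => F (G w)) z (m * l)%C.
Proof. rewrite (is_Cderive_ring G). apply (@is_derive_comp C_AbsRing C_NormedModule). Qed.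

Lemma Cmod_sub_sym (z w : C) : Cmod (z - w) = Cmod (w - z).
Proof. rewrite <- (Cmod_opp (z - w)). f_equal. ring. Qed.

Lemma Cmod_tri_inv (z w : C) : Cmod z - Cmod w <= Cmod (z - w).
Proof.
  pose proof (Cmod_triangle (z - w) w) as H. replace (z - w + w)%C with z in H by ring. lra.
Qed.

Lemma is_Cderive_inv (z : C) : z <> 0 -> is_Cderive Cinv z (- / (z * z))%C.
Proof.
  intros Hz. apply is_Cderive_eps. intros e He.
  assert (Hm : 0 < Cmod z) by (apply Cmod_gt_0; exact Hz).
  set (k := Cmod z) in *.
  (* The first radius keeps |w| above k / 2; then the error |w - z|^2 / (k^2 |w|) is at most |w -
     z|^2 * 2 / k^3, which the second radius brings below e |w - z|. *)
  exists (Rmin (k / 2) (e * k * k * k / 2)). split.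
  - apply Rmin_glb_lt; [lra|]. repeat apply Rmult_lt_0_compat; lra.
  - intros w Hw.
    assert (H1 : Cmod (w - z) < k / 2) by (eapply Rlt_le_trans; [exact Hw|apply Rmin_l]).
    assert (H2 : Cmod (w - z) < e * k * k * k / 2) by (eapply Rlt_le_trans; [exact Hw|apply Rmin_r]).
    assert (Hw2 : k / 2 < Cmod w).
    { pose proof (Cmod_tri_inv z w). rewrite Cmod_sub_sym in H. fold k in H. lra. }
    assert (Hw0 : w <> 0) by (apply Cmod_gt_0; lra).
    replace (/ w - / z - (w - z) * - / (z * z))%C
      with ((w - z) * (w - z) * / (z * z * w))%C by (field; auto).
    rewrite !Cmod_mult, Cmod_inv, !Cmod_mult by (repeat apply Cmult_neq_0; auto).
    fold k. rewrite (Rmult_comm e), !Rmult_assoc. apply Rmult_le_compat_l; [apply Cmod_ge_0|].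
    apply Rle_trans with ((e * k * k * k / 2) * / (k * (k * (k / 2)))).
    + apply Rmult_le_compat; [apply Cmod_ge_0| |lra|].
      * apply Rlt_le, Rinv_0_lt_compat. repeat apply Rmult_lt_0_compat; lra.
      * apply Rinv_le_contravar; [repeat apply Rmult_lt_0_compat; lra|].
        repeat (apply Rmult_le_compat_l; [lra|]). lra.
    + right. field. lra.
Qed.

Lemma is_Cderive_div (F G : C -> C) (z l m : C) :
  is_Cderive F z l -> is_Cderive G z m -> G z <> 0 ->
  is_Cderive (fun w => F w / G w)%C z ((l * G z - F z * m) / (G z * G z))%C.
Proof.
  intros HF HG Hz.
  replace ((l * G z - F z * m) / (G z * G z))%C
    with (l * / G z + F z * (m * (- / (G z * G z))))%C by (field; auto).
  apply (is_Cderive_mult F (fun w => / G w)%C); auto.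
  apply (is_Cderive_comp Cinv G); auto. apply is_Cderive_inv; auto.
Qed.

Lemma is_Cderive_pow (n : nat) (z : C) :
  is_Cderive (fun w => w ^ S n)%C z (RtoC (INR (S n)) * z ^ n)%C.
Proof.
  induction n as [|n IH].
  - apply (is_Cderive_ext_loc (fun w => w) _ z _ 1); [lra| |].
    + intros w _. simpl. ring.
    + replace (RtoC (INR 1) * z ^ 0)%C with (RtoC 1) by (simpl; ring). apply is_Cderive_id.
  - replace (RtoC (INR (S (S n))) * z ^ S n)%C
      with (RtoC 1 * z ^ S n + z * (RtoC (INR (S n)) * z ^ n))%C.
    + apply (is_Cderive_mult (fun w => w) (fun w => w ^ S n)%C); auto. apply is_Cderive_id.
    + rewrite (S_INR (S n)), RtoC_plus. simpl Cpow. ring.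
Qed.

Lemma is_Cderive_cont (F : C -> C) (z l : C) : is_Cderive F z l -> Ccont F z.
Proof.
  intros H. apply is_Cderive_eps with (e := 1) in H; [|lra].
  destruct H as (r & Hr & H). apply Ccont_eps. intros e He.
  set (M := 1 + Cmod l). assert (HM : 0 < M) by (unfold M; pose proof (Cmod_ge_0 l); lra).
  exists (Rmin r (e / M)). split; [apply Rmin_glb_lt; auto; apply Rdiv_lt_0_compat; auto|].
  intros w Hw.
  assert (H1 := Rlt_le_trans _ _ _ Hw (Rmin_l _ _)).
  assert (H2 := Rlt_le_trans _ _ _ Hw (Rmin_r _ _)).
  specialize (H w H1).
  replace (F w - F z)%C with ((F w - F z - (w - z) * l) + (w - z) * l)%C by ring.
  eapply Rle_lt_trans; [apply Cmod_triangle|]. rewrite Cmod_mult.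
  apply Rle_lt_trans with (Cmod (w - z) * M); [unfold M; lra|].
  apply Rlt_le_trans with (e / M * M); [apply Rmult_lt_compat_r; auto|].
  right; field; lra.
Qed.

Lemma Ccont_minus (F G : C -> C) (z : C) :
  Ccont F z -> Ccont G z -> Ccont (fun w => F w - G w)%C z.
Proof. apply (@continuous_minus C_UniformSpace R_AbsRing C_R_NormedModule). Qed.

Lemma Ccont_mult (F G : C -> C) (z : C) :
  Ccont F z -> Ccont G z -> Ccont (fun w => F w * G w)%C z.
Proof.
  intros HF HG.
  assert (H : forall F : C -> C, Ccont F z ->
     @continuous C_UniformSpace (AbsRing_UniformSpace C_AbsRing) F z).
  { intros K HK P HP. apply HK. apply locally_C. exact HP. }
  intros P HP. apply locally_C in HP.
  exact (@continuous_mult C_UniformSpace C_AbsRing F G z (H F HF) (H G HG) P HP).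
Qed.

Lemma ex_Cderive_cont (F : C -> C) (z : C) : ex_Cderive F z -> Ccont F z.
Proof. intros [l H]. eapply is_Cderive_cont; eauto. Qed.

Lemma C_derive_spec (F : C -> C) (z : C) : ex_Cderive F z -> is_Cderive F z (C_derive F z).
Proof. apply C_derive_correct. exact z. Qed.

Lemma C_derive_eq (F : C -> C) (z l : C) : is_Cderive F z l -> C_derive F z = l.
Proof. apply is_C_derive_unique. Qed.

Lemma Rcont_horiz (F : C -> C) (x y : R) : Ccont F (x, y) -> Rcont (fun t => F (t, y)) x.
Proof.
  intros H P HP. apply H in HP. apply locally_Cmod in HP. destruct HP as (r & Hr & HP).
  exists (mkposreal r Hr). intros t Ht. apply HP.
  replace ((t, y) - (x, y))%C with (RtoC (t - x)).
  - rewrite Cmod_R. exact Ht.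
  - unfold RtoC, Cminus, Cplus, Copp; simpl; f_equal; ring.
Qed.

Lemma Rcont_vert (F : C -> C) (x y : R) : Ccont F (x, y) -> Rcont (fun t => F (x, t)) y.
Proof.
  intros H P HP. apply H in HP. apply locally_Cmod in HP. destruct HP as (r & Hr & HP).
  exists (mkposreal r Hr). intros t Ht. apply HP.
  replace ((x, t) - (x, y))%C with (Ci * RtoC (t - y))%C.
  - rewrite Cmod_mult, Cmod_R, Cmod_Ci, Rmult_1_l. exact Ht.
  - unfold Ci, RtoC, Cminus, Cplus, Copp, Cmult; simpl; f_equal; ring.
Qed.

Lemma is_derive_affine_path (F : C -> C) (p v l : C) (x : R) :
  is_Cderive F (p + RtoC x * v)%C l ->
  @is_derive R_AbsRing C_R_NormedModule (fun t => F (p + RtoC t * v)%C) x (v * l)%C.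
Proof.
  intros H. split; [apply (@is_linear_scal_l R_AbsRing C_R_NormedModule)|].
  intros x' Hx. apply (@is_filter_lim_locally_unique R_AbsRing R_NormedModule) in Hx. subst x'.
  intros [e He].
  (* The added 1 keeps [M] positive when v = 0, so that one may divide by it. *)
  set (M := Cmod v + 1). assert (HM : 0 < M) by (unfold M; pose proof (Cmod_ge_0 v); lra).
  apply is_Cderive_eps with (e := e / M) in H; [|apply Rdiv_lt_0_compat; auto].
  destruct H as (r & Hr & H).
  exists (mkposreal (r / M) (Rdiv_lt_0_compat _ _ Hr HM)). intros t Ht.
  assert (Ht' : Rabs (t - x) < r / M) by exact Ht.
  change (@norm R_AbsRing C_R_NormedModule
    (F (p + RtoC t * v) - F (p + RtoC x * v) - @scal R_Ring C_R_ModuleSpace (t - x)%R (v * l))%C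
     <= e * Rabs (t - x)).
  rewrite norm_C_R, scal_R_Cmult.
  assert (E : (p + RtoC t * v - (p + RtoC x * v))%C = (RtoC (t - x) * v)%C)
    by (rewrite RtoC_minus; ring).
  assert (Hb : Cmod (RtoC (t - x) * v) <= Rabs (t - x) * M).
  { rewrite Cmod_mult, Cmod_R. apply Rmult_le_compat_l; [apply Rabs_pos|unfold M; lra]. }
  specialize (H (p + RtoC t * v)%C). rewrite E in H.
  replace (RtoC (t - x) * (v * l))%C with (RtoC (t - x) * v * l)%C by ring.
  eapply Rle_trans; [apply H|].
  - eapply Rle_lt_trans; [apply Hb|]. apply Rlt_le_trans with (r / M * M); [|right; field; lra].
    apply Rmult_lt_compat_r; auto.
  - apply Rle_trans with (e / M * (Rabs (t - x) * M)).
    + apply Rmult_le_compat_l; auto. apply Rlt_le, Rdiv_lt_0_compat; auto.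
    + right; field; lra.
Qed.

Lemma Rcont_affine_path (F : C -> C) (p v : C) (x : R) :
  Ccont F (p + RtoC x * v)%C -> Rcont (fun t => F (p + RtoC t * v)%C) x.
Proof.
  intros H. apply (continuous_comp (fun t : R => (p + RtoC t * v)%C : C_UniformSpace) F); auto.
  apply (@ex_derive_continuous R_AbsRing C_R_NormedModule).
  eexists. apply (is_derive_affine_path (fun w => w)). apply is_Cderive_id.
Qed.

Lemma ex_CInt_cont (f : R -> C) (a b : R) :
  a <= b -> (forall t, a <= t <= b -> Rcont f t) -> ex_CInt f a b.
Proof.
  intros Hab H. apply (@ex_RInt_continuous C_R_CompleteNormedModule).
  rewrite Rmin_left, Rmax_right by auto. exact H.
Qed.

Lemma Cmod_CInt_le (f : R -> C) (a b M : R) :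
  a <= b -> ex_CInt f a b -> (forall t, a <= t <= b -> Cmod (f t) <= M) ->
  Cmod (CInt f a b) <= (b - a) * M.
Proof.
  intros Hab Hf H. rewrite <- norm_C_R.
  apply (@norm_RInt_le_const C_R_NormedModule f a b); auto.
  - intros t Ht. rewrite norm_C_R. auto.
  - apply (@RInt_correct C_R_CompleteNormedModule); auto.
Qed.

(* [scal] of the real module [C] only allows real factors. *)
Lemma is_CInt_mult (c : C) (f : R -> C) (a b : R) (l : C) :
  is_CInt f a b l -> is_CInt (fun t => c * f t)%C a b (c * l)%C.
Proof.
  intros H.
  pose proof (@is_RInt_fct_extend_fst R_NormedModule R_NormedModule f a b l H) as H1.
  pose proof (@is_RInt_fct_extend_snd R_NormedModule R_NormedModule f a b l H) as H2.
  apply (@is_RInt_fct_extend_pair R_NormedModule R_NormedModule).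
  - apply (@is_RInt_minus R_NormedModule (fun t => fst c * fst (f t)) (fun t => snd c * snd (f t))).
    + apply (@is_RInt_scal R_NormedModule); auto.
    + apply (@is_RInt_scal R_NormedModule); auto.
  - apply (@is_RInt_plus R_NormedModule (fun t => fst c * snd (f t)) (fun t => snd c * fst (f t))).
    + apply (@is_RInt_scal R_NormedModule); auto.
    + apply (@is_RInt_scal R_NormedModule); auto.
Qed.

Lemma CInt_mult (c : C) (f : R -> C) (a b : R) :
  ex_CInt f a b -> CInt (fun t => c * f t)%C a b = (c * CInt f a b)%C.
Proof.
  intros H. apply (@is_RInt_unique C_R_CompleteNormedModule). apply is_CInt_mult.
  apply (@RInt_correct C_R_CompleteNormedModule); auto.
Qed.

Lemma CInt_plus (f g : R -> C) (a b : R) :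
  ex_CInt f a b -> ex_CInt g a b ->
  CInt (fun t => f t + g t)%C a b = (CInt f a b + CInt g a b)%C.
Proof. apply (@RInt_plus C_R_CompleteNormedModule). Qed.

Lemma CInt_minus (f g : R -> C) (a b : R) :
  ex_CInt f a b -> ex_CInt g a b ->
  CInt (fun t => f t - g t)%C a b = (CInt f a b - CInt g a b)%C.
Proof. apply (@RInt_minus C_R_CompleteNormedModule). Qed.

Lemma CInt_Chasles (f : R -> C) (a b c : R) :
  ex_CInt f a b -> ex_CInt f b c -> CInt f a c = (CInt f a b + CInt f b c)%C.
Proof. intros. symmetry. apply (@RInt_Chasles C_R_CompleteNormedModule); auto. Qed.

Lemma CInt_ext (f g : R -> C) (a b : R) :
  a <= b -> (forall t, a <= t <= b -> f t = g t) -> CInt f a b = CInt g a b.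
Proof.
  intros Hab H. apply (@RInt_ext C_R_CompleteNormedModule).
  rewrite Rmin_left, Rmax_right by auto. intros; apply H; lra.
Qed.

Lemma CInt_affine_path (F F' : C -> C) (p v : C) (a b : R) :
  a <= b ->
  (forall t, a <= t <= b -> is_Cderive F (p + RtoC t * v)%C (F' (p + RtoC t * v)%C)) ->
  (forall t, a <= t <= b -> Ccont F' (p + RtoC t * v)%C) ->
  is_CInt (fun t => v * F' (p + RtoC t * v))%C a b (F (p + RtoC b * v) - F (p + RtoC a * v))%C.
Proof.
  intros Hab Hd Hc.
  apply (@is_RInt_derive C_R_CompleteNormedModule (fun t => F (p + RtoC t * v)%C)
     (fun t => v * F' (p + RtoC t * v))%C); rewrite Rmin_left, Rmax_right by auto; intros t Ht.
  - apply is_derive_affine_path. auto.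
  - apply (continuous_comp (fun t => F' (p + RtoC t * v)%C : C_UniformSpace) (Cmult v : C_UniformSpace -> C_UniformSpace)).
    + apply Rcont_affine_path. auto.
    + apply is_Cderive_cont with (l := (RtoC 0 * F' (p + RtoC t * v) + v * RtoC 1)%C).
      apply (is_Cderive_mult (fun _ => v) (fun w => w)); [apply is_Cderive_const|apply is_Cderive_id].
Qed.

(** Complex values admit no intermediate point, so the increment is written as the integral of F'
    along the segment; hence the continuity assumed of F'. *)
Lemma mean_value_bound (F F' : C -> C) (z w : C) (M : R) :
  (forall t, 0 <= t <= 1 -> is_Cderive F (z + RtoC t * (w - z))%C (F' (z + RtoC t * (w - z))%C)) ->
  (forall t, 0 <= t <= 1 -> Ccont F' (z + RtoC t * (w - z))%C) ->
  (forall t, 0 <= t <= 1 -> Cmod (F' (z + RtoC t * (w - z))%C) <= M) ->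
  Cmod (F w - F z) <= M * Cmod (w - z).
Proof.
  intros Hd Hc HM.
  pose proof (CInt_affine_path F F' z (w - z) 0 1 ltac:(lra) Hd Hc) as H.
  replace (z + RtoC 1 * (w - z))%C with w in H by ring.
  replace (z + RtoC 0 * (w - z))%C with z in H by ring.
  rewrite <- (@is_RInt_unique C_R_CompleteNormedModule _ _ _ _ H).
  eapply Rle_trans; [apply Cmod_CInt_le with (M := Cmod (w - z) * M)|]; try lra.
  - eexists; eauto.
  - intros t Ht. rewrite Cmod_mult. apply Rmult_le_compat_l; [apply Cmod_ge_0|auto].
Qed.

Lemma segment_in_disc (r t : R) (z w : C) :
  0 <= t <= 1 -> Cmod z < r -> Cmod w < r -> Cmod (z + RtoC t * (w - z)) < r.
Proof.
  intros Ht Hz Hw.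
  replace (z + RtoC t * (w - z))%C with (RtoC (1 - t) * z + RtoC t * w)%C by (rewrite RtoC_minus; ring).
  eapply Rle_lt_trans; [apply Cmod_triangle|]. rewrite !Cmod_mult, !Cmod_R, !Rabs_right by lra.
  (* One weight may vanish; strictness is taken from the endpoint whose weight is at least 1/2. *)
  destruct (Rle_lt_dec t (1/2)).
  - apply Rlt_le_trans with ((1 - t) * r + t * r); [|lra].
    apply Rplus_lt_le_compat; [apply Rmult_lt_compat_l|apply Rmult_le_compat_l]; lra.
  - apply Rlt_le_trans with ((1 - t) * r + t * r); [|lra].
    apply Rplus_le_lt_compat; [apply Rmult_le_compat_l|apply Rmult_lt_compat_l]; lra.
Qed.

(** * Goursat's lemma and Cauchy's formula on squares *)

(* Counterclockwise integral over the boundary of the square [a, a+s] x [b, b+s]. *)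
Definition bdry (F : C -> C) (a b s : R) : C :=
  (CInt (fun x => F (x, b)) a (a + s) + Ci * CInt (fun y => F ((a + s)%R, y)) b (b + s)
   - CInt (fun x => F (x, (b + s)%R)) a (a + s) - Ci * CInt (fun y => F (a, y)) b (b + s))%C.

Definition on_square (a b s : R) (z : C) : Prop :=
  a <= fst z <= a + s /\ b <= snd z <= b + s.

Definition on_bdry (a b s : R) (z : C) : Prop :=
  on_square a b s z /\ (fst z = a \/ fst z = a + s \/ snd z = b \/ snd z = b + s).

Ltac on_bdry_tac := unfold on_bdry, on_square; simpl; repeat split; try lra; tauto.

Lemma ex_CInt_bdry (F : C -> C) (a b s : R) :
  0 <= s -> (forall z, on_bdry a b s z -> Ccont F z) ->
  ex_CInt (fun x => F (x, b)) a (a + s) /\ ex_CInt (fun y => F ((a + s)%R, y)) b (b + s) /\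
  ex_CInt (fun x => F (x, (b + s)%R)) a (a + s) /\ ex_CInt (fun y => F (a, y)) b (b + s).
Proof.
  intros Hs H. repeat split; apply ex_CInt_cont; try lra; intros t Ht.
  - apply (Rcont_horiz F), H. on_bdry_tac.
  - apply (Rcont_vert F), H. on_bdry_tac.
  - apply (Rcont_horiz F), H. on_bdry_tac.
  - apply (Rcont_vert F), H. on_bdry_tac.
Qed.

Lemma bdry_ext (F G : C -> C) (a b s : R) :
  0 <= s -> (forall z, on_bdry a b s z -> F z = G z) -> bdry F a b s = bdry G a b s.
Proof.
  intros Hs H. unfold bdry. f_equal; [f_equal; [f_equal; [|f_equal]|]|f_equal]; apply CInt_ext; try lra;
    intros; apply H; on_bdry_tac.
Qed.

Lemma bdry_minus (F G : C -> C) (a b s : R) :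
  0 <= s -> (forall z, on_bdry a b s z -> Ccont F z) -> (forall z, on_bdry a b s z -> Ccont G z) ->
  bdry (fun z => F z - G z)%C a b s = (bdry F a b s - bdry G a b s)%C.
Proof.
  intros Hs HF HG. destruct (ex_CInt_bdry F a b s Hs HF) as (F1 & F2 & F3 & F4).
  destruct (ex_CInt_bdry G a b s Hs HG) as (G1 & G2 & G3 & G4).
  unfold bdry. rewrite !CInt_minus by assumption. ring.
Qed.

Lemma bdry_mult (c : C) (F : C -> C) (a b s : R) :
  0 <= s -> (forall z, on_bdry a b s z -> Ccont F z) ->
  bdry (fun z => c * F z)%C a b s = (c * bdry F a b s)%C.
Proof.
  intros Hs HF. destruct (ex_CInt_bdry F a b s Hs HF) as (F1 & F2 & F3 & F4).
  unfold bdry. rewrite !CInt_mult by assumption. ring.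
Qed.

Lemma Cmod_bdry_le (F : C -> C) (a b s M : R) :
  0 <= s -> (forall z, on_bdry a b s z -> Ccont F z) ->
  (forall z, on_bdry a b s z -> Cmod (F z) <= M) -> Cmod (bdry F a b s) <= 4 * s * M.
Proof.
  intros Hs HF HM. destruct (ex_CInt_bdry F a b s Hs HF) as (F1 & F2 & F3 & F4).
  unfold bdry.
  assert (I1 : Cmod (CInt (fun x => F (x, b)) a (a + s)) <= (a + s - a) * M).
  { apply Cmod_CInt_le; auto; [lra|]. intros; apply HM; on_bdry_tac. }
  assert (I2 : Cmod (CInt (fun y => F ((a + s)%R, y)) b (b + s)) <= (b + s - b) * M).
  { apply Cmod_CInt_le; auto; [lra|]. intros; apply HM; on_bdry_tac. }
  assert (I3 : Cmod (CInt (fun x => F (x, (b + s)%R)) a (a + s)) <= (a + s - a) * M).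
  { apply Cmod_CInt_le; auto; [lra|]. intros; apply HM; on_bdry_tac. }
  assert (I4 : Cmod (CInt (fun y => F (a, y)) b (b + s)) <= (b + s - b) * M).
  { apply Cmod_CInt_le; auto; [lra|]. intros; apply HM; on_bdry_tac. }
  unfold Cminus. eapply Rle_trans; [apply Cmod_triangle|]. rewrite Cmod_opp, Cmod_mult, Cmod_Ci.
  eapply Rle_trans; [apply Rplus_le_compat_r, Cmod_triangle|]. rewrite Cmod_opp.
  eapply Rle_trans; [apply Rplus_le_compat_r, Rplus_le_compat_r, Cmod_triangle|].
  rewrite Cmod_mult, Cmod_Ci. lra.
Qed.

Lemma Cpath_horiz (x y : R) : (x, y) = (RtoC 0 + Ci * RtoC y + RtoC x * RtoC 1)%C.
Proof. unfold RtoC, Ci, Cplus, Cmult; simpl; f_equal; ring. Qed.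

Lemma Cpath_vert (x y : R) : (x, y) = (RtoC x + RtoC y * Ci)%C.
Proof. unfold RtoC, Ci, Cplus, Cmult; simpl; f_equal; ring. Qed.

Lemma CInt_horiz (F F' : C -> C) (y a b : R) :
  a <= b -> (forall t, a <= t <= b -> is_Cderive F (t, y) (F' (t, y))) ->
  (forall t, a <= t <= b -> Ccont F' (t, y)) ->
  CInt (fun t => F' (t, y)) a b = (F (b, y) - F (a, y))%C.
Proof.
  intros Hab Hd Hc. apply (@is_RInt_unique C_R_CompleteNormedModule).
  rewrite (Cpath_horiz b), (Cpath_horiz a).
  eapply (@is_RInt_ext C_R_NormedModule).
  2:{ apply (CInt_affine_path F F' (RtoC 0 + Ci * RtoC y)%C (RtoC 1) a b); auto;
      intros t Ht; rewrite <- Cpath_horiz; auto. }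
  intros t _. simpl. rewrite <- Cpath_horiz. apply Cmult_1_l.
Qed.

Lemma CInt_vert (F F' : C -> C) (x a b : R) :
  a <= b -> (forall t, a <= t <= b -> is_Cderive F (x, t) (F' (x, t))) ->
  (forall t, a <= t <= b -> Ccont F' (x, t)) ->
  (Ci * CInt (fun t => F' (x, t)) a b)%C = (F (x, b) - F (x, a))%C.
Proof.
  intros Hab Hd Hc. rewrite <- CInt_mult.
  2:{ apply ex_CInt_cont; auto. intros t Ht. apply Rcont_vert; auto. }
  apply (@is_RInt_unique C_R_CompleteNormedModule).
  rewrite (Cpath_vert x b), (Cpath_vert x a).
  eapply (@is_RInt_ext C_R_NormedModule).
  2:{ apply (CInt_affine_path F F' (RtoC x) Ci a b); auto;
      intros t Ht; rewrite <- Cpath_vert; auto. }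
  intros t _. simpl. rewrite <- Cpath_vert. reflexivity.
Qed.

(** The increments of the primitive along the four sides cancel at the corners. *)
Lemma bdry_primitive (F F' : C -> C) (a b s : R) :
  0 <= s -> (forall z, on_bdry a b s z -> is_Cderive F z (F' z)) ->
  (forall z, on_bdry a b s z -> Ccont F' z) -> bdry F' a b s = RtoC 0.
Proof.
  intros Hs Hd Hc. unfold bdry.
  rewrite (CInt_horiz F), (CInt_vert F), (CInt_horiz F), (CInt_vert F);
    try lra; try (intros; apply Hd; on_bdry_tac); try (intros; apply Hc; on_bdry_tac).
  ring.
Qed.

(** Each inner edge is traversed twice, in opposite directions. *)
Lemma bdry_quarter (F : C -> C) (a b s : R) :
  0 <= s -> (forall z, on_square a b s z -> Ccont F z) ->
  bdry F a b s = (bdry F a b (s / 2) + bdry F (a + s / 2) b (s / 2)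
    + bdry F a (b + s / 2) (s / 2) + bdry F (a + s / 2) (b + s / 2) (s / 2))%C.
Proof.
  intros Hs H.
  assert (Hx : forall y u v, b <= y <= b + s -> a <= u -> u <= v -> v <= a + s ->
     ex_CInt (fun x => F (x, y)) u v).
  { intros y u v Hy Hu Huv Hv. apply ex_CInt_cont; auto. intros t Ht. apply Rcont_horiz, H.
    unfold on_square; simpl; lra. }
  assert (Hy : forall x u v, a <= x <= a + s -> b <= u -> u <= v -> v <= b + s ->
     ex_CInt (fun y => F (x, y)) u v).
  { intros x u v Hy Hu Huv Hv. apply ex_CInt_cont; auto. intros t Ht. apply Rcont_vert, H.
    unfold on_square; simpl; lra. }
  unfold bdry.
  replace (a + s / 2 + s / 2) with (a + s) by lra.
  replace (b + s / 2 + s / 2) with (b + s) by lra.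
  rewrite (CInt_Chasles (fun x => F (x, b)) a (a + s / 2) (a + s)) by (apply Hx; lra).
  rewrite (CInt_Chasles (fun x => F (x, (b + s)%R)) a (a + s / 2) (a + s)) by (apply Hx; lra).
  rewrite (CInt_Chasles (fun y => F (a, y)) b (b + s / 2) (b + s)) by (apply Hy; lra).
  rewrite (CInt_Chasles (fun y => F ((a + s)%R, y)) b (b + s / 2) (b + s)) by (apply Hy; lra).
  ring.
Qed.

(** * Bisection of squares and Goursat's lemma *)

Record square := Square { sq_x : R; sq_y : R; sq_s : R }.

(** Compactness of the square as an induction principle. If [P] failed, repeated quartering would
    yield nested failing squares shrinking to a point (u, v), against the local hypothesis at that
    point. *)
Lemma square_bisection (P : square -> Prop) :
  (forall a b s, 0 < s -> P (Square a b (s / 2)) -> P (Square (a + s / 2) b (s / 2)) ->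
     P (Square a (b + s / 2) (s / 2)) -> P (Square (a + s / 2) (b + s / 2) (s / 2)) ->
     P (Square a b s)) ->
  (forall u v, exists e, 0 < e /\ forall a b s, 0 < s < e -> a <= u <= a + s ->
     b <= v <= b + s -> P (Square a b s)) ->
  forall a b s, 0 < s -> P (Square a b s).
Proof.
  intros Hq Hloc a0 b0 s0 Hs0. apply NNPP. intros Hbad.
  (* The failure is stored in the type, so that the choice of a failing quarter can be iterated. *)
  set (Bad := {q : square | 0 < sq_s q /\ ~ P q}).
  assert (Hnext : forall q : Bad, exists q' : Bad,
     sq_s (proj1_sig q') = sq_s (proj1_sig q) / 2 /\
     sq_x (proj1_sig q) <= sq_x (proj1_sig q') <= sq_x (proj1_sig q) + sq_s (proj1_sig q) / 2 /\
     sq_y (proj1_sig q) <= sq_y (proj1_sig q') <= sq_y (proj1_sig q) + sq_s (proj1_sig q) / 2).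
  { intros [[a b s] [Hs Hb]]; simpl in *.
    assert (Hs2 : 0 < s / 2) by lra.
    apply NNPP. intros Hno. apply Hb. apply Hq; auto; apply NNPP; intros Hc; apply Hno.
    - exists (exist _ (Square a b (s / 2)) (conj Hs2 Hc)). simpl. lra.
    - exists (exist _ (Square (a + s / 2) b (s / 2)) (conj Hs2 Hc)). simpl. lra.
    - exists (exist _ (Square a (b + s / 2) (s / 2)) (conj Hs2 Hc)). simpl. lra.
    - exists (exist _ (Square (a + s / 2) (b + s / 2) (s / 2)) (conj Hs2 Hc)).
      simpl. lra. }
  set (next := fun q => proj1_sig (constructive_indefinite_description _ (Hnext q))).
  set (q := fun n => Nat.iter n next
              (exist _ (Square a0 b0 s0) (conj Hs0 Hbad) : Bad)).
  set (X := fun n => sq_x (proj1_sig (q n))).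
  set (Y := fun n => sq_y (proj1_sig (q n))).
  set (S := fun n => sq_s (proj1_sig (q n))).
  assert (Hstep : forall n, S (1 + n)%nat = S n / 2 /\ X n <= X (1 + n)%nat <= X n + S n / 2
     /\ Y n <= Y (1 + n)%nat <= Y n + S n / 2).
  { intros n. unfold S, X, Y. change (q (1 + n)%nat) with (next (q n)). unfold next.
    apply (proj2_sig (constructive_indefinite_description _ (Hnext (q n)))). }
  assert (HS : forall n, S n = s0 * (/ 2) ^ n).
  { induction n as [|n IH]; [unfold S; simpl; ring|].
    destruct (Hstep n) as [E _]. simpl in E. rewrite E, IH. simpl. field. }
  assert (HSpos : forall n, 0 < S n) by (intros n; apply (proj2_sig (q n))).
  (* Nested intervals: the left ends increase and stay below every right end, so their supremum lies
     in all of them. *)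
  assert (Hlim : forall Z : nat -> R,
     (forall n, Z n <= Z (1 + n)%nat <= Z n + S n / 2) ->
     exists u, forall n, Z n <= u <= Z n + S n).
  { intros Z HZ.
    assert (Hup : forall n k, Z n <= Z (k + n)%nat /\ Z (k + n)%nat + S (k + n)%nat <= Z n + S n).
    { intros n. induction k as [|k IH]; [simpl; lra|].
      specialize (HZ (k + n)%nat). destruct (Hstep (k + n)%nat) as [E _].
      change (Datatypes.S k + n)%nat with (1 + (k + n))%nat.
      pose proof (HSpos (k + n)%nat). lra. }
    destruct (completeness (fun x => exists n, x = Z n)) as [u [Hu1 Hu2]].
    - exists (Z 0%nat + S 0%nat). intros x [n ->].
      pose proof (Hup 0%nat n). rewrite Nat.add_0_r in H. pose proof (HSpos n). lra.
    - exists (Z 0%nat), 0%nat. reflexivity.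
    - exists u. intros n. split; [apply Hu1; exists n; reflexivity|].
      apply Hu2. intros x [m ->].
      destruct (Nat.le_ge_cases n m) as [Hnm|Hnm].
      + replace m with ((m - n) + n)%nat by lia.
        pose proof (Hup n (m - n)%nat). pose proof (HSpos ((m - n) + n)%nat). lra.
      + pose proof (Hup m (n - m)%nat) as H. replace ((n - m) + m)%nat with n in H by lia.
        pose proof (HSpos n). lra. }
  destruct (Hlim X) as [u Hu]; [intros n; apply (Hstep n)|].
  destruct (Hlim Y) as [v Hv]; [intros n; apply (Hstep n)|].
  destruct (Hloc u v) as (e & He & HP).
  destruct (pow_lt_1_zero (/ 2) ltac:(rewrite Rabs_right; lra) (e / s0)
     ltac:(apply Rdiv_lt_0_compat; auto)) as [n Hn].
  specialize (Hn n (Nat.le_refl n)).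
  apply (proj2 (proj2_sig (q n))).
  replace (proj1_sig (q n)) with (Square (X n) (Y n) (S n))
    by (unfold X, Y, S; destruct (proj1_sig (q n)); reflexivity).
  apply HP; auto. split; auto. rewrite HS.
  rewrite Rabs_right in Hn by (apply Rle_ge, Rlt_le, pow_lt; lra).
  apply (Rmult_lt_compat_l s0) in Hn; auto. replace (s0 * (e / s0)) with e in Hn by (field; lra).
  exact Hn.
Qed.

(* A point mass at [w] on intervals [a, a+s], additive under bisection: [w] counts
   twice when interior and once when an endpoint. *)
Definition mass (w a s : R) : R := sign (a + s - w) - sign (a - w).

Lemma mass_bounds (w a s : R) : 0 <= s -> 0 <= mass w a s <= 2.
Proof.
  intros Hs. unfold mass. split.
  - assert (sign (a - w) <= sign (a + s - w)) by (apply sign_le; lra). lra.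
  - assert (H : forall x, -1 <= sign x <= 1).
    { intros x. destruct (Rtotal_order x 0) as [Hx|[->|Hx]];
        [rewrite sign_eq_m1|rewrite sign_0|rewrite sign_eq_1]; lra. }
    pose proof (H (a + s - w)). pose proof (H (a - w)). lra.
Qed.

Lemma mass_in (w a s : R) : 0 < s -> a <= w <= a + s -> 1 <= mass w a s.
Proof.
  intros Hs Hw. unfold mass.
  destruct (Rle_lt_or_eq_dec _ _ (proj1 Hw)) as [H|H].
  - rewrite (sign_eq_m1 (a - w)) by lra.
    destruct (Rle_lt_or_eq_dec _ _ (proj2 Hw)) as [H'|H'].
    + rewrite sign_eq_1 by lra. lra.
    + rewrite H', Rminus_diag, sign_0. lra.
  - rewrite H, Rminus_diag, sign_0, sign_eq_1 by lra. lra.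
Qed.

Lemma mass_split (w a s : R) : mass w a s = mass w a (s / 2) + mass w (a + s / 2) (s / 2).
Proof. unfold mass. replace (a + s / 2 + s / 2) with (a + s) by lra. lra. Qed.

Lemma on_square_dist (a b s : R) (z w : C) :
  on_square a b s z -> on_square a b s w -> Cmod (z - w) <= 2 * s.
Proof.
  destruct z as [x y], w as [u v]. intros [H1 H2] [H3 H4]; simpl in *.
  replace ((x, y) - (u, v))%C with (RtoC (x - u) + Ci * RtoC (y - v))%C
    by (apply injective_projections; simpl; ring).
  eapply Rle_trans; [apply Cmod_triangle|]. rewrite Cmod_mult, Cmod_Ci, !Cmod_R.
  assert (Rabs (x - u) <= s) by (apply Rabs_le; lra).
  assert (Rabs (y - v) <= s) by (apply Rabs_le; lra). lra.
Qed.

Lemma is_Cderive_shift (z0 z : C) : is_Cderive (fun w => w - z0)%C z (RtoC 1).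
Proof.
  replace (RtoC 1) with (RtoC 1 - RtoC 0)%C by ring.
  apply (is_Cderive_minus (fun z => z) (fun _ => z0)); [apply is_Cderive_id|apply is_Cderive_const].
Qed.

Lemma is_Cderive_affine (c l z0 z : C) : is_Cderive (fun w => c + (w - z0) * l)%C z l.
Proof.
  assert (H : is_Cderive (fun w => c + (w - z0) * l)%C z (RtoC 0 + (RtoC 1 * l + (z - z0) * RtoC 0))%C).
  { apply (is_Cderive_plus (fun _ => c) (fun w => (w - z0) * l)%C); [apply is_Cderive_const|].
    apply (is_Cderive_mult (fun w => w - z0)%C (fun _ => l)); [|apply is_Cderive_const].
    apply is_Cderive_shift. }
  replace (RtoC 0 + (RtoC 1 * l + (z - z0) * RtoC 0))%C with l in H by ring. exact H.
Qed.

Lemma bdry_affine (c l z0 : C) (a b s : R) :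
  0 <= s -> bdry (fun z => c + (z - z0) * l)%C a b s = RtoC 0.
Proof.
  intros Hs.
  apply (bdry_primitive (fun z => c * z + l * / RtoC 2 * ((z - z0) * (z - z0)))%C); auto.
  - intros z _.
    assert (H2 : RtoC 2 <> RtoC 0) by (intros E; apply RtoC_inj in E; lra).
    set (l2 := (l * / RtoC 2)%C).
    replace (c + (z - z0) * l)%C
      with (RtoC 0 * z + c * RtoC 1 + (RtoC 0 * ((z - z0) * (z - z0)) + l2 *
        (RtoC 1 * (z - z0) + (z - z0) * RtoC 1)))%C by (unfold l2; field; auto).
    apply (is_Cderive_plus (fun z => c * z)%C (fun z => l2 * ((z - z0) * (z - z0)))%C).
    + apply (is_Cderive_mult (fun _ => c) (fun z => z)); [apply is_Cderive_const|apply is_Cderive_id].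
    + apply (is_Cderive_mult (fun _ => l2) (fun z => (z - z0) * (z - z0))%C); [apply is_Cderive_const|].
      apply (is_Cderive_mult (fun z => z - z0)%C (fun z => z - z0)%C); apply is_Cderive_shift.
  - intros z _. eapply is_Cderive_cont, is_Cderive_affine.
Qed.

(* The additive majorant [e s^2 + e mass] of [|bdry F|] is what bisection preserves; its
   second term pays for the exceptional point [w]. *)
Theorem Goursat_square (F : C -> C) (a b s : R) (w : C) :
  0 < s -> (forall z, on_square a b s z -> Ccont F z) ->
  (forall z, on_square a b s z -> z <> w -> ex_Cderive F z) ->
  bdry F a b s = RtoC 0.
Proof.
  intros Hs Hc Hd.
  (* The 4 bounds the product of the two masses, each being at most 2. *)
  assert (Hmain : forall e, 0 < e -> Cmod (bdry F a b s) <= e * (s * s + 4)).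
  2:{ apply Cmod_eq_0. apply Rle_antisym; [|apply Cmod_ge_0].
      apply Rnot_lt_le. intros Hpos. set (m := Cmod (bdry F a b s)) in *.
      assert (Hss : 0 < s * s + 4) by (pose proof (Rmult_lt_0_compat s s Hs Hs); lra).
      specialize (Hmain (m / (s * s + 4) / 2)).
      replace (m / (s * s + 4) / 2 * (s * s + 4)) with (m / 2) in Hmain by (field; lra).
      apply Rlt_irrefl with m. eapply Rle_lt_trans; [apply Hmain|lra].
      apply Rdiv_lt_0_compat; [apply Rdiv_lt_0_compat|]; lra. }
  intros e He.
  set (inside := fun a' b' s' => a <= a' /\ a' + s' <= a + s /\ b <= b' /\ b' + s' <= b + s).
  set (P := fun q => inside (sq_x q) (sq_y q) (sq_s q) ->
     Cmod (bdry F (sq_x q) (sq_y q) (sq_s q)) <=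
       e * (sq_s q * sq_s q) + e * (mass (fst w) (sq_x q) (sq_s q) * mass (snd w) (sq_y q) (sq_s q))).
  assert (HP : P (Square a b s)).
  { apply square_bisection; auto.
    - intros a' b' s' Hs' P1 P2 P3 P4 Hin. unfold P, inside in *. simpl in *.
      specialize (P1 ltac:(lra)). specialize (P2 ltac:(lra)).
      specialize (P3 ltac:(lra)). specialize (P4 ltac:(lra)).
      rewrite bdry_quarter; [|lra|].
      2:{ intros z [Hz1 Hz2]. apply Hc. split; lra. }
      rewrite (mass_split (fst w) a' s'), (mass_split (snd w) b' s').
      eapply Rle_trans; [apply Cmod_triangle|].
      eapply Rle_trans; [apply Rplus_le_compat_r, Cmod_triangle|].
      eapply Rle_trans; [apply Rplus_le_compat_r, Rplus_le_compat_r, Cmod_triangle|].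
      lra.
    - intros u v. destruct (classic (on_square a b s (u, v))) as [Huv|Huv].
      2:{ exists 1. split; [lra|]. intros a' b' s' Hs' Hu Hv Hin. exfalso. apply Huv.
          unfold inside in Hin; simpl in Hin. split; simpl; lra. }
      destruct (classic ((u, v) = w)) as [Ew|Ew].
      (* At [w] only continuity is available. It gives |bdry F| <= 4 s' M, which is below e once s'
         < e / (4 M); the mass term is at least e here and absorbs it. *)
      + destruct (proj1 (Ccont_eps F w) ltac:(rewrite <- Ew; auto) 1 ltac:(lra)) as (r & Hr & HF).
        set (M := Cmod (F w) + 1).
        assert (HM : 0 < M) by (unfold M; pose proof (Cmod_ge_0 (F w)); lra).
        exists (Rmin (r / 2) (e / (4 * M))). split.
        { apply Rmin_glb_lt; [lra|]. apply Rdiv_lt_0_compat; lra. }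
        intros a' b' s' Hs' Hu Hv Hin. unfold P; simpl.
        assert (H1 := Rlt_le_trans _ _ _ (proj2 Hs') (Rmin_l _ _)).
        assert (H2 := Rlt_le_trans _ _ _ (proj2 Hs') (Rmin_r _ _)).
        eapply Rle_trans; [apply Cmod_bdry_le with (M := M)|].
        * lra.
        * intros z [[Hz1 Hz2] _]. apply Hc. unfold inside in Hin; simpl in Hin. split; lra.
        * intros z [Hz _]. assert (Hzw : Cmod (z - w) < r).
          { eapply Rle_lt_trans; [apply (on_square_dist a' b' s'); auto|lra].
            rewrite <- Ew. split; auto. }
          specialize (HF z Hzw). replace (F z) with ((F z - F w) + F w)%C by ring.
          eapply Rle_trans; [apply Cmod_triangle|]. unfold M. lra.
        * pose proof (mass_in (fst w) a' s' ltac:(lra) ltac:(rewrite <- Ew; auto)) as M1.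
          pose proof (mass_in (snd w) b' s' ltac:(lra) ltac:(rewrite <- Ew; auto)) as M2.
          apply Rmult_lt_compat_r with (r := 4 * M) in H2; [|lra].
          replace (e / (4 * M) * (4 * M)) with e in H2 by (field; lra).
          assert (1 * 1 <= mass (fst w) a' s' * mass (snd w) b' s')
            by (apply Rmult_le_compat; lra).
          apply Rmult_le_compat_l with (r := e) in H; [|lra].
          pose proof (Rmult_lt_0_compat e (s' * s') He (Rmult_lt_0_compat _ _ (proj1 Hs') (proj1 Hs'))).
          lra.
      (* Elsewhere the affine approximation integrates to 0, and the remaining error, at most (e /
         8) (2 s') on a boundary of length 4 s', contributes at most e s'^2. *)
      + destruct (Hd (u, v) Huv Ew) as [l Hl].
        destruct (proj1 (is_Cderive_eps F (u, v) l) Hl (e / 8) ltac:(lra)) as (r & Hr & HF).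
        exists (r / 2). split; [lra|]. intros a' b' s' Hs' Hu Hv Hin. unfold P; simpl.
        unfold inside in Hin; simpl in Hin.
        assert (Hsub : forall z, on_bdry a' b' s' z -> Ccont F z).
        { intros z [[Hz1 Hz2] _]. apply Hc. split; lra. }
        assert (Haff : forall z, Ccont (fun z => F (u, v) + (z - (u, v)) * l)%C z).
        { intros z. eapply is_Cderive_cont, is_Cderive_affine. }
        replace (bdry F a' b' s')
          with (bdry (fun z => F z - (F (u, v) + (z - (u, v)) * l))%C a' b' s').
        2:{ rewrite bdry_minus, bdry_affine; auto; try lra. ring. }
        eapply Rle_trans; [apply Cmod_bdry_le with (M := e / 8 * (2 * s'))|].
        * lra.
        * intros z Hz. apply Ccont_minus; [apply Hsub; auto|apply Haff].
        * intros z [Hz _].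
          assert (Hzd : Cmod (z - (u, v)) <= 2 * s') by (apply (on_square_dist a' b' s'); auto; split; auto).
          replace (F z - (F (u, v) + (z - (u, v)) * l))%C
            with (F z - F (u, v) - (z - (u, v)) * l)%C by ring.
          eapply Rle_trans; [apply HF; lra|]. apply Rmult_le_compat_l; lra.
        * pose proof (mass_bounds (fst w) a' s' ltac:(lra)) as [M1 _].
          pose proof (mass_bounds (snd w) b' s' ltac:(lra)) as [M2 _].
          pose proof (Rmult_le_pos _ _ M1 M2) as M3.
          apply Rmult_le_compat_l with (r := e) in M3; lra. }
  specialize (HP ltac:(unfold inside; simpl; lra)). simpl in HP.
  pose proof (mass_bounds (fst w) a s ltac:(lra)) as M1.
  pose proof (mass_bounds (snd w) b s ltac:(lra)) as M2.
  assert (mass (fst w) a s * mass (snd w) b s <= 2 * 2) by (apply Rmult_le_compat; lra).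
  apply Rmult_le_compat_l with (r := e) in H; lra.
Qed.

(** Compactness again by [square_bisection]. [P] bounds F only at points of the big square, so the
    position of the subsquares need not be tracked. *)
Lemma bounded_on_square (F : C -> C) (a b s : R) :
  0 < s -> (forall z, on_square a b s z -> Ccont F z) ->
  exists B, forall z, on_square a b s z -> Cmod (F z) <= B.
Proof.
  intros Hs Hc.
  set (P := fun q => exists B, forall z, on_square (sq_x q) (sq_y q) (sq_s q) z ->
     on_square a b s z -> Cmod (F z) <= B).
  assert (HP : P (Square a b s)).
  { apply square_bisection; auto.
    - intros a' b' s' Hs' [B1 H1] [B2 H2] [B3 H3] [B4 H4]. simpl in *.
      exists (Rmax (Rmax B1 B2) (Rmax B3 B4)). intros z [Hx Hy] Hz. simpl in *.
      destruct (Rle_lt_dec (fst z) (a' + s' / 2)) as [Cx|Cx];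
      destruct (Rle_lt_dec (snd z) (b' + s' / 2)) as [Cy|Cy].
      + eapply Rle_trans; [apply H1|eapply Rle_trans; [apply Rmax_l|apply Rmax_l]]; auto; split; lra.
      + eapply Rle_trans; [apply H3|eapply Rle_trans; [apply Rmax_l|apply Rmax_r]]; auto; split; lra.
      + eapply Rle_trans; [apply H2|eapply Rle_trans; [apply Rmax_r|apply Rmax_l]]; auto; split; lra.
      + eapply Rle_trans; [apply H4|eapply Rle_trans; [apply Rmax_r|apply Rmax_r]]; auto; split; lra.
    - intros u v. destruct (classic (on_square a b s (u, v))) as [Huv|Huv].
      + destruct (proj1 (Ccont_eps F (u, v)) (Hc _ Huv) 1 ltac:(lra)) as (r & Hr & HF).
        exists (r / 2). split; [lra|]. intros a' b' s' Hs' Hu Hv.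
        exists (Cmod (F (u, v)) + 1). simpl. intros z Hz _.
        assert (Cmod (z - (u, v)) <= 2 * s') by (apply (on_square_dist a' b' s'); auto; split; auto).
        specialize (HF z ltac:(lra)). pose proof (Cmod_tri_inv (F z) (F (u, v))). lra.
      + assert (exists e, 0 < e /\ forall x y, Rabs (x - u) < e -> Rabs (y - v) < e ->
           ~ on_square a b s (x, y)) as (e & He & Hno).
        { assert (Hout : u < a \/ a + s < u \/ v < b \/ b + s < v).
          { apply NNPP. intros H. apply Huv. split; simpl; lra. }
          destruct Hout as [H|[H|[H|H]]]; [exists (a - u)|exists (u - (a + s))|exists (b - v)|exists (v - (b + s))];
            (split; [lra|]); intros x y Hx Hy [H1 H2]; simpl in *;
            apply Rabs_def2 in Hx; apply Rabs_def2 in Hy; lra. }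
        (* A small square about an outside point misses the big square, so any bound serves. *)
        exists e. split; auto. intros a' b' s' Hs' Hu Hv. exists 0. simpl.
        intros [x y] [H1 H2] Hz. simpl in *. exfalso.
        apply (Hno x y); auto; apply Rabs_def1; lra. }
  destruct HP as [B HB]. exists B. intros z Hz. apply HB; auto.
Qed.

(** * Cauchy integrals, Cauchy's formula and the derivative of the derivative *)

(** Differentiation under the integral sign: a remainder quadratic in w - w0, uniformly in z, stays
    quadratic after integration. *)
Lemma is_Cderive_bdry_param (H : C -> C -> C) (H' : C -> C) (w0 : C) (a b s e M : R) :
  0 <= s -> 0 < e -> 0 <= M ->
  (forall w z, Cmod (w - w0) < e -> on_bdry a b s z -> Ccont (H w) z) ->
  (forall z, on_bdry a b s z -> Ccont H' z) ->
  (forall w z, Cmod (w - w0) < e -> on_bdry a b s z ->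
     Cmod (H w z - H w0 z - (w - w0) * H' z) <= M * (Cmod (w - w0) * Cmod (w - w0))) ->
  is_Cderive (fun w => bdry (H w) a b s) w0 (bdry H' a b s).
Proof.
  intros Hs He HM Hc Hc' Hb. apply is_Cderive_eps. intros e' He'.
  assert (HsM : 0 <= 4 * s * M) by (apply Rmult_le_pos; lra).
  (* The added 1 covers the case 4 s M = 0. *)
  exists (Rmin e (e' / (4 * s * M + 1))). split.
  { apply Rmin_glb_lt; auto. apply Rdiv_lt_0_compat; lra. }
  intros w Hw.
  assert (Hw1 := Rlt_le_trans _ _ _ Hw (Rmin_l _ _)).
  assert (Hw2 := Rlt_le_trans _ _ _ Hw (Rmin_r _ _)).
  assert (H0 : Cmod (w0 - w0) < e) by (replace (w0 - w0)%C with (RtoC 0) by ring; rewrite Cmod_0; auto).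
  assert (Hm : forall z, on_bdry a b s z -> Ccont (fun z => (w - w0) * H' z)%C z).
  { intros z Hz. apply Ccont_mult; [apply continuous_const|auto]. }
  assert (Hd : forall z, on_bdry a b s z -> Ccont (fun z => H w z - H w0 z)%C z).
  { intros z Hz. apply Ccont_minus; auto. }
  rewrite <- bdry_mult by auto. rewrite <- bdry_minus by auto. rewrite <- bdry_minus by auto.
  eapply Rle_trans; [apply Cmod_bdry_le with (M := M * (Cmod (w - w0) * Cmod (w - w0)))|]; auto.
  - intros z Hz. apply Ccont_minus; auto.
  - pose proof (Cmod_ge_0 (w - w0)) as Hp.
    replace (4 * s * (M * (Cmod (w - w0) * Cmod (w - w0))))
      with ((4 * s * M * Cmod (w - w0)) * Cmod (w - w0)) by ring.
    apply Rmult_le_compat_r; auto.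
    apply Rle_trans with ((4 * s * M + 1) * Cmod (w - w0)); [apply Rmult_le_compat_r; lra|].
    apply Rle_trans with ((4 * s * M + 1) * (e' / (4 * s * M + 1))); [apply Rmult_le_compat_l; lra|].
    right. field. lra.
Qed.

Lemma on_bdry_Cmod (c : R) (z : C) : 0 < c -> on_bdry (- c) (- c) (2 * c) z -> c <= Cmod z.
Proof.
  intros Hc [[H1 H2] H]. pose proof (Rmax_Cmod z) as Hm.
  pose proof (Rmax_l (Rabs (fst z)) (Rabs (snd z))).
  pose proof (Rmax_r (Rabs (fst z)) (Rabs (snd z))).
  pose proof (Rle_abs (fst z)). pose proof (Rle_abs (snd z)).
  pose proof (Rabs_maj2 (fst z)). pose proof (Rabs_maj2 (snd z)). lra.
Qed.

(** The coordinates add up to at most 2 c; 3 c leaves room for a strict bound and is the radius that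
    [Cauchy_formula] asks for. *)
Lemma on_square_Cmod (c : R) (z : C) : 0 < c -> on_square (- c) (- c) (2 * c) z -> Cmod z < 3 * c.
Proof.
  intros Hc [H1 H2]. destruct z as [x y]; simpl in *.
  replace ((x, y) : C) with (RtoC x + RtoC y * Ci)%C by (symmetry; apply Cpath_vert).
  eapply Rle_lt_trans; [apply Cmod_triangle|]. rewrite Cmod_mult, Cmod_Ci, !Cmod_R.
  assert (Rabs x <= c) by (apply Rabs_le; lra).
  assert (Rabs y <= c) by (apply Rabs_le; lra). lra.
Qed.

Lemma Cinv_bound (z : C) (k : R) : 0 < k -> k <= Cmod z -> z <> RtoC 0 /\ Cmod (/ z) <= / k.
Proof.
  intros Hk Hz. assert (H0 : z <> RtoC 0) by (apply Cmod_gt_0; lra). split; auto.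
  rewrite Cmod_inv by auto. apply Rinv_le_contravar; auto.
Qed.

(* [c] is half the side of the square. *)
Definition cauchy_int (n : nat) (phi : C -> C) (c : R) (w : C) : C :=
  bdry (fun z => phi z * (/ (z - w)) ^ n)%C (- c) (- c) (2 * c).

Lemma is_Cderive_pow_inv (n : nat) (z w : C) :
  z <> w -> exists l, is_Cderive (fun z => (/ (z - w)) ^ n)%C z l.
Proof.
  intros Hz. assert (H0 : (z - w <> 0)%C) by (apply Cminus_eq_contra; auto).
  destruct n as [|n].
  - exists (RtoC 0). apply (is_Cderive_const (RtoC 1)).
  - eexists. apply (is_Cderive_comp (fun u => u ^ S n)%C (fun z => / (z - w))%C).
    + apply is_Cderive_pow.
    + apply (is_Cderive_comp Cinv (fun z => z - w)%C); [apply is_Cderive_inv; auto|apply is_Cderive_shift].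
Qed.

(** The case n = 1 expresses F' as a Cauchy integral, and the case n = 2 differentiates it once
    more. *)
Lemma is_Cderive_cauchy_int (n : nat) (phi : C -> C) (c : R) (w0 : C) :
  (n = 1 \/ n = 2)%nat -> 0 < c ->
  (forall z, on_square (- c) (- c) (2 * c) z -> Ccont phi z) -> Cmod w0 < c / 2 ->
  is_Cderive (cauchy_int n phi c) w0 (RtoC (INR n) * cauchy_int (S n) phi c w0)%C.
Proof.
  intros Hn Hc Hphi Hw0.
  destruct (bounded_on_square phi (- c) (- c) (2 * c) ltac:(lra) Hphi) as [B0 HB0].
  set (B := Rabs B0). assert (HBpos : 0 <= B) by apply Rabs_pos.
  assert (HB : forall z, on_square (- c) (- c) (2 * c) z -> Cmod (phi z) <= B).
  { intros z Hz. eapply Rle_trans; [apply HB0; auto|apply Rle_abs]. }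
  (* As |w0| < c / 2, the boundary stays at distance c / 2 from w0, hence at distance c / 4 from
     every w within c / 4 of w0. *)
  set (k := c / 2). assert (Hk : 0 < k) by (unfold k; lra).
  assert (Hz0 : forall z, on_bdry (- c) (- c) (2 * c) z -> k <= Cmod (z - w0)).
  { intros z Hz. pose proof (on_bdry_Cmod c z Hc Hz). pose proof (Cmod_tri_inv z w0).
    unfold k. lra. }
  assert (Hdist : exists e, 0 < e /\ forall w z, Cmod (w - w0) < e ->
     on_bdry (- c) (- c) (2 * c) z -> e <= Cmod (z - w)).
  { exists (k / 2). split; [lra|]. intros w z Hw Hz. specialize (Hz0 z Hz).
    pose proof (Cmod_tri_inv (z - w0) (w - w0)).
    replace (z - w0 - (w - w0))%C with (z - w)%C in H by ring. lra. }
  destruct Hdist as (e & He & Hdist).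
  assert (Hcont : forall m w z, Cmod (w - w0) < e -> on_bdry (- c) (- c) (2 * c) z ->
     Ccont (fun z => phi z * (/ (z - w)) ^ m)%C z).
  { intros m w z Hw Hz. apply Ccont_mult; [apply Hphi, Hz|].
    destruct (Cinv_bound (z - w) e He (Hdist w z Hw Hz)) as [Hne _].
    assert (Hzw : z <> w) by (intros ->; apply Hne; ring).
    destruct (is_Cderive_pow_inv m z w Hzw) as [l Hl]. eapply is_Cderive_cont; eauto. }
  assert (H0e : Cmod (w0 - w0) < e) by (replace (w0 - w0)%C with (RtoC 0) by ring; rewrite Cmod_0; auto).
  unfold cauchy_int at 2. rewrite <- bdry_mult; [|lra|intros; apply Hcont; auto].
  assert (Hei : 0 < / e) by (apply Rinv_0_lt_compat; auto).
  (* With A = 1 / (z - w0) and D = 1 / (z - w), the remainder is (w - w0)^2 phi(z) A^2 D for n = 1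
     and (w - w0)^2 phi(z) (2 A^3 D + A^2 D^2) for n = 2; the two summands of [M] bound these in
     turn, the 3 being 2 + 1. *)
  apply is_Cderive_bdry_param with (e := e)
    (M := B * (/ e * / e * / e) + B * (3 * (/ e * / e * / e * / e)));
    try lra.
  - apply Rplus_le_le_0_compat; repeat apply Rmult_le_pos; lra.
  - intros w z Hw Hz. apply Hcont; auto.
  - intros z Hz. apply Ccont_mult; [apply continuous_const|]. apply Hcont; auto.
  - intros w z Hw Hz.
    destruct (Cinv_bound (z - w) e He (Hdist w z Hw Hz)) as [Hw1 Hw2].
    destruct (Cinv_bound (z - w0) e He (Hdist w0 z H0e Hz)) as [Hw3 Hw4].
    specialize (HB z (proj1 Hz)).
    set (A := (/ (z - w0))%C) in *. set (D := (/ (z - w))%C) in *.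
    pose proof (Cmod_ge_0 A). pose proof (Cmod_ge_0 D). pose proof (Cmod_ge_0 (phi z)).
    assert (T1 : Cmod (phi z) * (Cmod A * Cmod A * Cmod D) <= B * (/ e * / e * / e)).
    { repeat (apply Rmult_le_compat; repeat apply Rmult_le_pos; auto). }
    assert (T2 : Cmod (phi z) * (Cmod A * Cmod A * Cmod A * Cmod D) <= B * (/ e * / e * / e * / e)).
    { repeat (apply Rmult_le_compat; repeat apply Rmult_le_pos; auto). }
    assert (T3 : Cmod (phi z) * (Cmod A * Cmod A * Cmod D * Cmod D) <= B * (/ e * / e * / e * / e)).
    { repeat (apply Rmult_le_compat; repeat apply Rmult_le_pos; auto). }
    pose proof (Cmod_ge_0 (w - w0)) as Hp.
    assert (Hp2 : 0 <= Cmod (w - w0) * Cmod (w - w0)) by (apply Rmult_le_pos; auto).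
    assert (N1 : 0 <= B * (/ e * / e * / e)) by (repeat apply Rmult_le_pos; lra).
    assert (N2 : 0 <= B * (/ e * / e * / e * / e)) by (repeat apply Rmult_le_pos; lra).
    destruct Hn as [-> | ->].
    + replace (phi z * D ^ 1 - phi z * A ^ 1 - (w - w0) * (RtoC (INR 1) * (phi z * A ^ 2)))%C
        with ((w - w0) * (w - w0) * (phi z * (A * A * D)))%C
        by (unfold A, D; simpl; field; auto).
      rewrite !Cmod_mult. rewrite Rmult_comm. apply Rmult_le_compat_r; lra.
    + replace (phi z * D ^ 2 - phi z * A ^ 2 - (w - w0) * (RtoC (INR 2) * (phi z * A ^ 3)))%C
        with ((w - w0) * (w - w0) * (RtoC 2 * (phi z * (A * A * A * D)) + phi z * (A * A * D * D)))%C
        by (unfold A, D; simpl INR; rewrite (RtoC_plus 1 1); simpl; field; auto).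
      rewrite Cmod_mult, Cmod_mult. rewrite Rmult_comm. apply Rmult_le_compat_r; auto.
      eapply Rle_trans; [apply Cmod_triangle|]. rewrite !Cmod_mult, Cmod_R, Rabs_right by lra. lra.
Qed.

(** The integral is 2 pi i, but an estimate suffices: after merging the four sides it lies within 2
    of 6 i. *)
Lemma winding_nonzero (c : R) : 0 < c -> cauchy_int 1 (fun _ => RtoC 1) c (RtoC 0) <> RtoC 0.
Proof.
  intros Hc. unfold cauchy_int.
  rewrite (bdry_ext _ Cinv) by (try lra; intros; simpl; replace (z - RtoC 0)%C with z by ring; ring).
  assert (Hcont : forall z, on_bdry (- c) (- c) (2 * c) z -> Ccont Cinv z).
  { intros z Hz. pose proof (on_bdry_Cmod c z Hc Hz).
    apply is_Cderive_cont with (l := (- / (z * z))%C). apply is_Cderive_inv.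
    apply Cmod_gt_0. lra. }
  destruct (ex_CInt_bdry Cinv (- c) (- c) (2 * c) ltac:(lra) Hcont) as (F1 & F2 & F3 & F4).
  unfold bdry. replace (- c + 2 * c) with c in * by ring.
  rewrite <- !CInt_mult by auto.
  assert (G2 : ex_CInt (fun y => Ci * Cinv (c, y))%C (- c) c).
  { destruct F2 as [l Hl]. eexists. apply is_CInt_mult. exact Hl. }
  assert (G4 : ex_CInt (fun y => Ci * Cinv ((- c)%R, y))%C (- c) c).
  { destruct F4 as [l Hl]. eexists. apply is_CInt_mult. exact Hl. }
  rewrite <- CInt_plus by auto.
  assert (G5 := @ex_RInt_plus C_R_NormedModule _ _ _ _ F1 G2).
  rewrite <- CInt_minus by auto.
  assert (G6 := @ex_RInt_minus C_R_NormedModule _ _ _ _ G5 F3).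
  rewrite <- CInt_minus by auto.
  assert (G7 := @ex_RInt_minus C_R_NormedModule _ _ _ _ G6 G4).
  intros H.
  (* On the sides the four integrands add up to [4 i c / (t^2 + c^2)], which lies within [1/c] of [3 i / c]. *)
  assert (Hb : Cmod (CInt (fun t => / (t, (- c)%R) + Ci * / (c, t) - / (t, c) - Ci * / ((- c)%R, t)
                 - (0%R, (3 / c)%R))%C (- c) c) <= (c - - c) * (1 / c)).
  { apply Cmod_CInt_le; [lra| |].
    - apply (@ex_RInt_minus C_R_NormedModule _ (fun _ => (0%R, (3 / c)%R))); auto.
      apply (@ex_RInt_const C_R_NormedModule).
    - intros t Ht.
      assert (Ht2 : 0 <= t * t <= c * c).
      { split; [apply Rle_0_sqr|]. apply Rsqr_le_abs_1. rewrite (Rabs_right c) by lra. apply Rabs_le; lra. }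
      assert (Hcc : 0 < c * c) by (apply Rmult_lt_0_compat; auto).
      replace (/ (t, (- c)%R) + Ci * / (c, t) - / (t, c) - Ci * / ((- c)%R, t) - (0%R, (3 / c)%R))%C
        with (Ci * RtoC (4 * c / (t * t + c * c) - 3 / c))%C.
      2:{ apply injective_projections; simpl; field; repeat split; try lra; nra. }
      rewrite Cmod_mult, Cmod_Ci, Cmod_R, Rmult_1_l.
      replace (4 * c / (t * t + c * c) - 3 / c)
        with ((c * c - 3 * (t * t)) * / ((t * t + c * c) * c)) by (field; lra).
      assert (Hpos : 0 < (t * t + c * c) * c) by (apply Rmult_lt_0_compat; lra).
      rewrite Rabs_mult, (Rabs_right (/ _)) by (apply Rle_ge, Rlt_le, Rinv_0_lt_compat; auto).
      apply Rmult_le_reg_r with ((t * t + c * c) * c); auto.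
      rewrite Rmult_assoc, Rinv_l, Rmult_1_r by lra.
      replace (1 / c * ((t * t + c * c) * c)) with (t * t + c * c) by (field; lra).
      apply Rabs_le. lra. }
  rewrite CInt_minus in Hb; auto; [|apply (@ex_RInt_const C_R_NormedModule)].
  rewrite H in Hb.
  rewrite (@is_RInt_unique C_R_CompleteNormedModule _ _ _ _
     (@is_RInt_const C_R_NormedModule (- c) c (0%R, (3 / c)%R))) in Hb.
  rewrite scal_R_Cmult in Hb.
  replace (RtoC 0 - RtoC (c - - c) * (0%R, (3 / c)%R))%C with (- (RtoC 6 * Ci))%C in Hb
    by (apply injective_projections; simpl; field; lra).
  rewrite Cmod_opp, Cmod_mult, Cmod_Ci, Cmod_R, Rabs_right in Hb by lra.
  replace ((c - - c) * (1 / c)) with 2 in Hb by (field; lra). lra.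
Qed.

(** The derivative in w is the boundary integral of (z - w)^(-2), which has the primitive -1 / (z -
    w) along the boundary and so vanishes. *)
Lemma winding_const (c : R) (w : C) : 0 < c -> Cmod w < c / 2 ->
  cauchy_int 1 (fun _ => RtoC 1) c w = cauchy_int 1 (fun _ => RtoC 1) c (RtoC 0).
Proof.
  intros Hc Hw.
  assert (Hd : forall v, Cmod v < c / 2 -> is_Cderive (cauchy_int 1 (fun _ => RtoC 1) c) v (RtoC 0)).
  { intros v Hv.
    pose proof (is_Cderive_cauchy_int 1 (fun _ => RtoC 1) c v (or_introl eq_refl) Hc
      (fun z _ => continuous_const _ _) Hv) as H.
    replace (RtoC (INR 1) * cauchy_int 2 (fun _ => RtoC 1) c v)%C with (RtoC 0) in H; auto.
    unfold cauchy_int.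
    assert (Hne : forall z, on_bdry (- c) (- c) (2 * c) z -> (z - v)%C <> RtoC 0).
    { intros z Hz. apply Cmod_gt_0. pose proof (on_bdry_Cmod c z Hc Hz).
      pose proof (Cmod_tri_inv z v). lra. }
    rewrite (bdry_primitive (fun z => (- RtoC 1)%C * / (z - v))%C); [ring|lra| |].
    - intros z Hz. specialize (Hne z Hz).
      replace (RtoC 1 * (/ (z - v)) ^ 2)%C
        with (RtoC 0 * / (z - v) + (- RtoC 1)%C * (RtoC 1 * - / ((z - v) * (z - v))))%C
        by (simpl; field; auto).
      apply (is_Cderive_mult (fun _ => (- RtoC 1)%C) (fun z => / (z - v))%C); [apply is_Cderive_const|].
      apply (is_Cderive_comp Cinv (fun z => z - v)%C); [apply is_Cderive_inv; auto|apply is_Cderive_shift].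
    - intros z Hz. apply Ccont_mult; [apply continuous_const|].
      destruct (is_Cderive_pow_inv 2 z v) as [l Hl]; [|eapply is_Cderive_cont; exact Hl].
      intros ->. apply (Hne v Hz). ring. }
  apply Ceq_minus, Cmod_eq_0. apply Rle_antisym; [|apply Cmod_ge_0].
  apply Rle_trans with (0 * Cmod (w - RtoC 0)); [|lra].
  assert (Hseg : forall t, 0 <= t <= 1 -> Cmod (RtoC 0 + RtoC t * (w - RtoC 0)) < c / 2).
  { intros t Ht. apply segment_in_disc; auto. rewrite Cmod_0; lra. }
  apply (mean_value_bound _ (fun _ => RtoC 0)).
  - intros t Ht. apply Hd. auto.
  - intros t Ht. apply continuous_const.
  - intros t Ht. rewrite Cmod_0. lra.
Qed.

(** The difference quotient of F at w, completed by F'(w), is continuous on the square and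
    differentiable off w. This is the exceptional point that [Goursat_square] allows. *)
Lemma Cauchy_formula (F : C -> C) (c : R) (w : C) : 0 < c ->
  (forall z, Cmod z < 3 * c -> ex_Cderive F z) -> Cmod w < c / 2 ->
  cauchy_int 1 F c w = (F w * cauchy_int 1 (fun _ => RtoC 1) c w)%C.
Proof.
  intros Hc HF Hw.
  destruct (HF w ltac:(lra)) as [l Hl].
  set (G := fun z => if Ceq_dec z w then l else ((F z - F w) / (z - w))%C).
  assert (Hne : forall z, on_bdry (- c) (- c) (2 * c) z -> z <> w).
  { intros z Hz ->. pose proof (on_bdry_Cmod c w Hc Hz). lra. }
  assert (Hcont : forall z, on_bdry (- c) (- c) (2 * c) z -> Ccont (fun z => (/ (z - w)) ^ 1)%C z).
  { intros z Hz. destruct (is_Cderive_pow_inv 1 z w (Hne z Hz)) as [l' Hl'].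
    eapply is_Cderive_cont; exact Hl'. }
  assert (HFc : forall z, on_square (- c) (- c) (2 * c) z -> Ccont F z).
  { intros z Hz. apply ex_Cderive_cont, HF, on_square_Cmod; auto. }
  assert (HGd : forall z, on_square (- c) (- c) (2 * c) z -> z <> w -> ex_Cderive G z).
  { intros z Hz Hzw. destruct (HF z (on_square_Cmod c z Hc Hz)) as [l' Hl'].
    eexists. apply (is_Cderive_ext_loc (fun z => (F z - F w) / (z - w))%C _ z _ (Cmod (z - w))).
    - apply Cmod_gt_0, Cminus_eq_contra. auto.
    - intros v Hv. unfold G. destruct (Ceq_dec v w) as [->|]; auto.
      rewrite Cmod_sub_sym in Hv. lra.
    - apply (is_Cderive_div (fun z => F z - F w)%C (fun z => z - w)%C).
      + apply (is_Cderive_minus F (fun _ => F w)); [exact Hl'|apply is_Cderive_const].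
      + apply is_Cderive_shift.
      + apply Cminus_eq_contra. auto. }
  assert (HG0 : bdry G (- c) (- c) (2 * c) = RtoC 0).
  { apply (Goursat_square G _ _ _ w); [lra| |auto].
    intros z Hz. destruct (Ceq_dec z w) as [->|Hzw]; [|apply ex_Cderive_cont; auto].
    apply Ccont_eps. intros e He.
    destruct (proj1 (is_Cderive_eps F w l) Hl (e / 2) ltac:(lra)) as (r & Hr & Hb).
    exists r. split; auto. intros v Hv. unfold G.
    destruct (Ceq_dec w w) as [_|]; [|congruence].
    destruct (Ceq_dec v w) as [->|Hvw].
    - replace (l - l)%C with (RtoC 0) by ring. rewrite Cmod_0; auto.
    - assert (H0 : (v - w)%C <> RtoC 0) by (apply Cminus_eq_contra; auto).
      assert (Hm : 0 < Cmod (v - w)) by (apply Cmod_gt_0; auto).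
      replace ((F v - F w) / (v - w) - l)%C with ((F v - F w - (v - w) * l) / (v - w))%C
        by (field; auto).
      rewrite Cmod_div by auto. apply Rle_lt_trans with (e / 2); [|lra].
      apply Rmult_le_reg_r with (Cmod (v - w)); auto.
      unfold Rdiv at 1. rewrite Rmult_assoc, Rinv_l, Rmult_1_r by lra. apply Hb; auto. }
  unfold cauchy_int.
  rewrite <- bdry_mult; [|lra|intros; apply Ccont_mult; [apply continuous_const|auto]].
  apply Ceq_minus. rewrite <- HG0. rewrite <- bdry_minus; [|lra| |].
  - apply bdry_ext; [lra|]. intros z Hz. unfold G.
    destruct (Ceq_dec z w) as [E|_]; [destruct (Hne z Hz E)|].
    simpl. field. apply Cminus_eq_contra. auto.
  - intros z Hz. apply Ccont_mult; [apply HFc, Hz|auto].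
  - intros z Hz. apply Ccont_mult; [apply continuous_const|].
    apply Ccont_mult; [apply continuous_const|auto].
Qed.

(** Dividing Cauchy's formula by the winding constant writes F as a Cauchy integral of order 1 near
    0; then F' is one of order 2, which can be differentiated again. With 3 c = r the square lies in
    the disc of radius r, and c / 2 = r / 6. *)
Theorem ex_Cderive_C_derive (F : C -> C) (r : R) : 0 < r ->
  (forall z, Cmod z < r -> ex_Cderive F z) ->
  forall w, Cmod w < r / 6 -> ex_Cderive (C_derive F) w.
Proof.
  intros Hr HF.
  set (c := r / 3). assert (Hc : 0 < c) by (unfold c; lra).
  set (N := cauchy_int 1 (fun _ => RtoC 1) c (RtoC 0)).
  assert (HN : N <> RtoC 0) by (apply winding_nonzero; auto).
  assert (HFc : forall z, on_square (- c) (- c) (2 * c) z -> Ccont F z).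
  { intros z Hz. apply ex_Cderive_cont, HF. pose proof (on_square_Cmod c z Hc Hz). unfold c in *. lra. }
  assert (Hrep : forall w, Cmod w < c / 2 -> F w = (/ N * cauchy_int 1 F c w)%C).
  { intros w Hw. rewrite Cauchy_formula; auto.
    - rewrite (winding_const c w) by auto. fold N. field. auto.
    - intros z Hz. apply HF. unfold c in Hz. lra. }
  assert (Hloc : forall w z, Cmod w < c / 2 -> Cmod (z - w) < c / 2 - Cmod w -> Cmod z < c / 2).
  { intros w z Hw Hz. pose proof (Cmod_tri_inv z w). lra. }
  assert (Hscal : forall (G : C -> C) z l, is_Cderive G z l -> is_Cderive (fun z => / N * G z)%C z (/ N * l)%C).
  { intros G z l HG. replace (/ N * l)%C with (RtoC 0 * G z + / N * l)%C by ring.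
    apply (is_Cderive_mult (fun _ => / N)%C G); auto. apply is_Cderive_const. }
  assert (Hrep' : forall w, Cmod w < c / 2 -> C_derive F w = (/ N * cauchy_int 2 F c w)%C).
  { intros w Hw. apply C_derive_eq.
    apply (is_Cderive_ext_loc (fun w => / N * cauchy_int 1 F c w)%C _ w _ (c / 2 - Cmod w)); [lra| |].
    - intros z Hz. symmetry. apply Hrep, (Hloc w); auto.
    - apply Hscal. replace (cauchy_int 2 F c w) with (RtoC (INR 1) * cauchy_int 2 F c w)%C
        by (simpl INR; ring). apply is_Cderive_cauchy_int; auto. }
  intros w Hw. assert (Hw' : Cmod w < c / 2) by (unfold c; lra).
  eexists. apply (is_Cderive_ext_loc (fun w => / N * cauchy_int 2 F c w)%C _ w _ (c / 2 - Cmod w)); [lra| |].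
  - intros z Hz. symmetry. apply Hrep', (Hloc w); auto.
  - apply Hscal, is_Cderive_cauchy_int; auto.
Qed.

(** * Expansions of germs *)

Definition near0 (P : C -> Prop) : Prop := exists r : R, 0 < r /\ forall z, Cmod z < r -> P z.

Lemma near0_and (P Q : C -> Prop) : near0 P -> near0 Q -> near0 (fun z => P z /\ Q z).
Proof.
  intros (r & Hr & HP) (s & Hs & HQ). exists (Rmin r s). split; [apply Rmin_glb_lt; auto|].
  intros z Hz. split; [apply HP|apply HQ]; eapply Rlt_le_trans; eauto; [apply Rmin_l|apply Rmin_r].
Qed.

Lemma near0_imp (P Q : C -> Prop) : (forall z, P z -> Q z) -> near0 P -> near0 Q.
Proof. intros H (r & Hr & HP). exists r. auto. Qed.

Lemma near0_comp (G : C -> C) (P : C -> Prop) :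
  Ccont G (RtoC 0) -> G (RtoC 0) = RtoC 0 -> near0 P -> near0 (fun z => P (G z)).
Proof.
  intros HG H0 (r & Hr & HP). destruct (proj1 (Ccont_eps _ _) HG r Hr) as (s & Hs & Hb).
  exists s. split; auto. intros z Hz. apply HP.
  replace (G z) with (G z - G (RtoC 0))%C by (rewrite H0; ring). apply Hb.
  replace (z - RtoC 0)%C with z by ring. auto.
Qed.

Lemma Ccont_plus (F G : C -> C) (z : C) :
  Ccont F z -> Ccont G z -> Ccont (fun w => F w + G w)%C z.
Proof. apply (@continuous_plus C_UniformSpace R_AbsRing C_R_NormedModule). Qed.

Lemma Ccont_pow (F : C -> C) (n : nat) (z : C) : Ccont F z -> Ccont (fun w => F w ^ n)%C z.
Proof.
  intros H. induction n as [|n IH]; [apply continuous_const|].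
  apply (Ccont_mult F (fun w => F w ^ n)%C); auto.
Qed.

Lemma Ccont_at0 (F : C -> C) :
  (forall e, 0 < e -> near0 (fun z => Cmod (F z - F (RtoC 0)) <= e)) -> Ccont F (RtoC 0).
Proof.
  intros H. apply Ccont_eps. intros e He. destruct (H (e / 2) ltac:(lra)) as (r & Hr & Hb).
  exists r. split; auto. intros w Hw. replace (w - RtoC 0)%C with w in Hw by ring.
  specialize (Hb w Hw). lra.
Qed.

(** Coefficients are compared this way: an identity divided by z^(p+1) holds off 0 only, and passes
    to the limit. *)
Lemma Ccont_punctured_eq (F G : C -> C) :
  Ccont F (RtoC 0) -> Ccont G (RtoC 0) -> near0 (fun z => z <> RtoC 0 -> F z = G z) ->
  F (RtoC 0) = G (RtoC 0).
Proof.
  intros HF HG (r & Hr & H).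
  apply Ceq_minus, NNPP. intros Hne. apply Cmod_gt_0 in Hne.
  set (m := Cmod (F (RtoC 0) - G (RtoC 0))) in *.
  destruct (proj1 (Ccont_eps _ _) (Ccont_minus F G _ HF HG) m Hne) as (s & Hs & Hb).
  set (t := Rmin r s / 2).
  assert (Ht : 0 < t /\ t < r /\ t < s).
  { unfold t. assert (0 < Rmin r s) by (apply Rmin_glb_lt; auto).
    pose proof (Rmin_l r s). pose proof (Rmin_r r s). lra. }
  assert (Hm : Cmod (RtoC t) = t) by (rewrite Cmod_R, Rabs_right; lra).
  specialize (Hb (RtoC t)). replace (RtoC t - RtoC 0)%C with (RtoC t) in Hb by ring.
  rewrite H in Hb.
  - replace (G (RtoC t) - G (RtoC t) - (F (RtoC 0) - G (RtoC 0)))%C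
      with (- (F (RtoC 0) - G (RtoC 0)))%C in Hb by ring.
    rewrite Cmod_opp in Hb. fold m in Hb. specialize (Hb ltac:(lra)). lra.
  - rewrite Hm. lra.
  - intros E. rewrite E, Cmod_0 in Hm. lra.
Qed.

Lemma holo_near0_C_derive (f : C -> C) : holo_near0 f -> holo_near0 (C_derive f).
Proof.
  intros (r & Hr & H). exists (r / 6). split; [lra|]. apply ex_Cderive_C_derive; auto.
Qed.

(* Mean value bound for [f - c z - A(0) z^(n+1) / (n+1)]. *)
Lemma integrate_expansion (f A : C -> C) (c : C) (n : nat) :
  holo_near0 f -> Ccont A (RtoC 0) ->
  near0 (fun z => C_derive f z = c + z ^ n * A z)%C ->
  exists B, Ccont B (RtoC 0) /\ (RtoC (INR (S n)) * B (RtoC 0) = A (RtoC 0))%C /\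
    near0 (fun z => f z = f (RtoC 0) + c * z + z ^ S n * B z)%C.
Proof.
  intros Hf HA HfA. pose proof (holo_near0_C_derive f Hf) as Hf'.
  assert (Hn : RtoC (INR (S n)) <> RtoC 0).
  { intros E. apply RtoC_inj in E. apply (not_0_INR (S n)); auto. }
  set (b := (A (RtoC 0) / RtoC (INR (S n)))%C).
  set (B := fun z => if Ceq_dec z (RtoC 0) then b else ((f z - f (RtoC 0) - c * z) / z ^ S n)%C).
  assert (HB0 : B (RtoC 0) = b) by (unfold B; destruct (Ceq_dec (RtoC 0) (RtoC 0)); congruence).
  exists B. repeat split.
  2:{ rewrite HB0. unfold b. field. auto. }
  2:{ exists 1. split; [lra|]. intros z _. unfold B. destruct (Ceq_dec z (RtoC 0)) as [->|Hz].
      - simpl. ring.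
      - field. apply Cpow_nz. auto. }
  apply Ccont_at0. intros e He.
  destruct (near0_and _ _ Hf (near0_and _ _ Hf' HfA)) as (r & Hr & H).
  destruct (proj1 (Ccont_eps _ _) HA e He) as (s & Hs & HAb).
  exists (Rmin r s). split; [apply Rmin_glb_lt; auto|]. intros z Hz.
  assert (Hzr := Rlt_le_trans _ _ _ Hz (Rmin_l _ _)).
  assert (Hzs := Rlt_le_trans _ _ _ Hz (Rmin_r _ _)).
  rewrite HB0. unfold B. destruct (Ceq_dec z (RtoC 0)) as [->|Hz0].
  { replace (b - b)%C with (RtoC 0) by ring. rewrite Cmod_0. lra. }
  set (F := fun z => (f z - (c * z + b * z ^ S n))%C).
  set (F' := fun z => (C_derive f z - (c + A (RtoC 0) * z ^ n))%C).
  assert (HF : Cmod (F z - F (RtoC 0)) <= (e * Cmod z ^ n) * Cmod (z - RtoC 0)).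
  { assert (Hseg : forall t, 0 <= t <= 1 -> Cmod (RtoC 0 + RtoC t * (z - RtoC 0)) <= Cmod z).
    { intros t Ht. replace (RtoC 0 + RtoC t * (z - RtoC 0))%C with (RtoC t * z)%C by ring.
      rewrite Cmod_mult, Cmod_R, Rabs_right by lra.
      rewrite <- (Rmult_1_l (Cmod z)) at 2. apply Rmult_le_compat_r; [apply Cmod_ge_0|lra]. }
    apply (mean_value_bound F F').
    - intros t Ht. specialize (Hseg t Ht). set (w := (RtoC 0 + RtoC t * (z - RtoC 0))%C) in *.
      destruct (H w ltac:(lra)) as [[l Hl] _].
      unfold F'. rewrite (C_derive_eq f w l Hl).
      apply (is_Cderive_minus f (fun z => c * z + b * z ^ S n)%C); auto.
      replace (c + A (RtoC 0) * w ^ n)%C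
        with (RtoC 0 * w + c * RtoC 1 + (RtoC 0 * w ^ S n + b * (RtoC (INR (S n)) * w ^ n)))%C
        by (unfold b; field; auto).
      apply (is_Cderive_plus (fun z => c * z)%C (fun z => b * z ^ S n)%C).
      + apply (is_Cderive_mult (fun _ => c) (fun z => z)); [apply is_Cderive_const|apply is_Cderive_id].
      + apply (is_Cderive_mult (fun _ => b) (fun z => z ^ S n)%C); [apply is_Cderive_const|apply is_Cderive_pow].
    - intros t Ht. specialize (Hseg t Ht). set (w := (RtoC 0 + RtoC t * (z - RtoC 0))%C) in *.
      destruct (H w ltac:(lra)) as [_ [Hd _]].
      apply (Ccont_minus (C_derive f) (fun z => c + A (RtoC 0) * z ^ n)%C).
      + apply ex_Cderive_cont; auto.
      + apply Ccont_plus; [apply continuous_const|]. apply Ccont_mult; [apply continuous_const|].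
        apply (Ccont_pow (fun z => z)). apply continuous_id.
    - intros t Ht. specialize (Hseg t Ht). set (w := (RtoC 0 + RtoC t * (z - RtoC 0))%C) in *.
      destruct (H w ltac:(lra)) as [_ [_ E]]. unfold F'. rewrite E.
      replace (c + w ^ n * A w - (c + A (RtoC 0) * w ^ n))%C with ((A w - A (RtoC 0)) * w ^ n)%C by ring.
      rewrite Cmod_mult, Cmod_pow. apply Rmult_le_compat; auto using Cmod_ge_0.
      + apply pow_le, Cmod_ge_0.
      + apply Rlt_le, HAb. replace (w - RtoC 0)%C with w by ring. lra.
      + apply pow_incr. split; [apply Cmod_ge_0|auto]. }
  assert (Hpz : (z ^ S n)%C <> RtoC 0) by (apply Cpow_nz; auto).
  assert (Hm : 0 < Cmod (z ^ S n)) by (apply Cmod_gt_0; auto).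
  replace ((f z - f (RtoC 0) - c * z) / z ^ S n - b)%C with ((F z - F (RtoC 0)) / z ^ S n)%C.
  2:{ unfold F. replace (RtoC 0 ^ S n)%C with (RtoC 0) by (simpl; ring). field. auto. }
  rewrite Cmod_div by auto. apply Rmult_le_reg_r with (Cmod (z ^ S n)); auto.
  unfold Rdiv. rewrite Rmult_assoc, Rinv_l, Rmult_1_r by lra.
  eapply Rle_trans; [exact HF|]. rewrite Cmod_pow. replace (z - RtoC 0)%C with z by ring.
  simpl. lra.
Qed.

Lemma Cderiv_n_C_derive (k : nat) (f : C -> C) : Cderiv_n k (C_derive f) = Cderiv_n (S k) f.
Proof. unfold Cderiv_n. symmetry. apply Nat.iter_succ_r. Qed.

(** Carathéodory's form of differentiability: a factorisation with a continuous slope, which can be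
    substituted without remainder terms. *)
Lemma caratheodory0 (f : C -> C) :
  holo_near0 f -> exists A, Ccont A (RtoC 0) /\ A (RtoC 0) = multiplier f /\
    near0 (fun z => f z = f (RtoC 0) + z * A z)%C.
Proof.
  intros (r & Hr & Hf).
  destruct (Hf (RtoC 0) ltac:(rewrite Cmod_0; auto)) as [l Hl].
  set (A := fun z => if Ceq_dec z (RtoC 0) then l else ((f z - f (RtoC 0)) / z)%C).
  assert (HA0 : A (RtoC 0) = l) by (unfold A; destruct (Ceq_dec (RtoC 0) (RtoC 0)); congruence).
  exists A. repeat split.
  - apply Ccont_at0. intros e He. destruct (proj1 (is_Cderive_eps _ _ _) Hl e He) as (s & Hs & Hb).
    exists s. split; auto. intros z Hz. rewrite HA0. unfold A.
    destruct (Ceq_dec z (RtoC 0)) as [->|Hz0].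
    { replace (l - l)%C with (RtoC 0) by ring. rewrite Cmod_0. lra. }
    specialize (Hb z). replace (z - RtoC 0)%C with z in Hb by ring.
    assert (Hm : 0 < Cmod z) by (apply Cmod_gt_0; auto).
    replace ((f z - f (RtoC 0)) / z - l)%C with ((f z - f (RtoC 0) - z * l) / z)%C by (field; auto).
    rewrite Cmod_div by auto. apply Rmult_le_reg_r with (Cmod z); auto.
    unfold Rdiv. rewrite Rmult_assoc, Rinv_l, Rmult_1_r by lra. auto.
  - rewrite HA0. symmetry. apply C_derive_eq; auto.
  - exists 1. split; [lra|]. intros z _. unfold A. destruct (Ceq_dec z (RtoC 0)) as [->|Hz].
    + ring.
    + field. auto.
Qed.

(** Induction through f', whose derivatives at 0 are those of f shifted by one; each integration
    divides the leading coefficient by the next integer, which builds the factorial. *)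
Lemma leading_term (n : nat) : forall f : C -> C,
  holo_near0 f -> (forall k, (1 <= k <= n)%nat -> Cderiv_n k f (RtoC 0) = RtoC 0) ->
  exists A, Ccont A (RtoC 0) /\
    (RtoC (INR (fact (S n))) * A (RtoC 0) = Cderiv_n (S n) f (RtoC 0))%C /\
    near0 (fun z => f z = f (RtoC 0) + z ^ S n * A z)%C.
Proof.
  induction n as [|n IH]; intros f Hf H.
  - destruct (caratheodory0 f Hf) as (A & HA & E & HfA). exists A. repeat split; auto.
    + rewrite E. change (fact 1) with 1%nat. simpl INR. rewrite Cmult_1_l. reflexivity.
    + apply (near0_imp _ _) with (2 := HfA). intros z ->. simpl. ring.
  - destruct (IH (C_derive f)) as (A & HA & E & HfA).
    + apply holo_near0_C_derive; auto.
    + intros k Hk. rewrite Cderiv_n_C_derive. apply H. lia.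
    + assert (H0 : C_derive f (RtoC 0) = RtoC 0) by (apply (H 1%nat); lia).
      rewrite H0 in HfA.
      destruct (integrate_expansion f A (RtoC 0) (S n) Hf HA HfA) as (B & HB & EB & HfB).
      exists B. repeat split; auto.
      * rewrite <- Cderiv_n_C_derive, <- E, <- EB.
        change (fact (S (S n))) with (S (S n) * fact (S n))%nat. rewrite mult_INR, RtoC_mult. ring.
      * apply (near0_imp _ _) with (2 := HfB). intros z ->. ring.
Qed.

(* [F z = z + a z^(p+1) + o(z^(p+1))] *)
Definition has_exp (p : nat) (F : C -> C) (a : C) : Prop :=
  exists A, Ccont A (RtoC 0) /\ A (RtoC 0) = a /\ near0 (fun z => F z = z + z ^ S p * A z)%C.

(** [leading_term] is applied to f', where the term z has become the constant 1 and the conditions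
    on f^(k), 2 <= k <= p, concern the orders 1 to p - 1. A vanishing coefficient would put f into
    G_(p+1). *)
Lemma has_exp_of_inAp (p : nat) (f : C -> C) :
  (1 <= p)%nat -> inAp p f -> exists a, a <> RtoC 0 /\ has_exp p f a.
Proof.
  intros Hp [[[[Hf [Hf0 _]] Hm] Hk] Hn].
  destruct p as [|n]; [lia|].
  destruct (leading_term n (C_derive f)) as (A & HA & E & HfA).
  - apply holo_near0_C_derive; auto.
  - intros k Hk'. rewrite Cderiv_n_C_derive. apply Hk. lia.
  - assert (E1 : C_derive f (RtoC 0) = RtoC 1) by exact Hm. rewrite E1 in HfA.
    destruct (integrate_expansion f A (RtoC 1) (S n) Hf HA HfA) as (B & HB & EB & HfB).
    exists (B (RtoC 0)). split.
    + intros HB0. apply Hn. split; [repeat split; auto|].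
      * rewrite Hm. apply C1_nz.
      * intros k Hk'. destruct (Nat.eq_dec k (S n + 1)) as [->|]; [|apply Hk; lia].
        replace (S n + 1)%nat with (S (S n)) by lia.
        rewrite <- Cderiv_n_C_derive, <- E, <- EB, HB0. ring.
    + exists B. repeat split; auto. apply (near0_imp _ _) with (2 := HfB).
      intros z ->. rewrite Hf0. ring.
Qed.

(** * The coefficient of z^(p+1) under composition, inversion and conjugation *)

Lemma Ccont_comp (F G : C -> C) (z : C) : Ccont G z -> Ccont F (G z) -> Ccont (fun w => F (G w)) z.
Proof. apply (continuous_comp (U := C_UniformSpace) (V := C_UniformSpace) (W := C_UniformSpace)). Qed.

Lemma Ccont_id (z : C) : Ccont (fun w => w) z.
Proof. apply continuous_id. Qed.

Lemma Ccont_cst (c z : C) : Ccont (fun _ => c) z.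
Proof. apply continuous_const. Qed.

Ltac ccont :=
  lazymatch goal with
  | |- Ccont (fun w => w) _ => apply Ccont_id
  | |- Ccont (fun _ => ?c) _ => apply Ccont_cst
  | |- Ccont (fun w => (@?F w + @?G w)%C) _ => apply (Ccont_plus F G); ccont
  | |- Ccont (fun w => (@?F w - @?G w)%C) _ => apply (Ccont_minus F G); ccont
  | |- Ccont (fun w => (@?F w * @?G w)%C) _ => apply (Ccont_mult F G); ccont
  | |- Ccont (fun w => (@?F w ^ ?n)%C) _ => apply (Ccont_pow F n); ccont
  | _ => try assumption
  end.

Lemma has_exp_id (p : nat) : has_exp p idC (RtoC 0).
Proof.
  exists (fun _ => RtoC 0). repeat split; [apply Ccont_cst|].
  exists 1. split; [lra|]. intros z _. unfold idC. ring.
Qed.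

Lemma has_exp_germ (p : nat) (F G : C -> C) (a : C) :
  germ_eq F G -> has_exp p F a -> has_exp p G a.
Proof.
  intros HFG (A & HA & E & H). exists A. repeat split; auto.
  destruct (near0_and _ _ HFG H) as (r & Hr & Hz). exists r. split; auto.
  intros z Hzr. destruct (Hz z Hzr) as [<- ?]. auto.
Qed.

(** Substituting K z = z (1 + z^p B z) turns K^(p+1) A(K) into z^(p+1) times a continuous factor.
    Its value at 0 is a because z^p vanishes there, which takes p >= 1. *)
Lemma has_exp_comp (p : nat) (F G : C -> C) (a b : C) : (1 <= p)%nat ->
  has_exp p F a -> has_exp p G b -> has_exp p (gcomp F G) (a + b)%C.
Proof.
  intros Hp (A & HA & Ea & HF) (B & HB & Eb & HG).
  set (K := fun z => (z + z ^ S p * B z)%C).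
  assert (HK : Ccont K (RtoC 0)) by (unfold K; ccont).
  assert (HK0 : K (RtoC 0) = RtoC 0) by (unfold K; simpl; ring).
  exists (fun z => (RtoC 1 + z ^ p * B z) ^ S p * A (K z) + B z)%C. repeat split.
  - ccont. apply (Ccont_comp A K); auto. rewrite HK0; auto.
  - rewrite HK0, Ea, Eb. destruct p as [|p]; [lia|].
    replace (RtoC 1 + RtoC 0 ^ S p * b)%C with (RtoC 1) by (simpl; ring).
    rewrite Cpow_1_l. change (@eq C (RtoC 1 * a + b) (a + b))%C. ring.
  - destruct (near0_and _ _ HG (near0_comp K _ HK HK0 HF)) as (r & Hr & H). exists r. split; auto.
    intros z Hz. destruct (H z Hz) as [H1 H2]. unfold gcomp. rewrite H1. fold (K z). rewrite H2.
    replace (z ^ S p * ((RtoC 1 + z ^ p * B z) ^ S p * A (K z) + B z))%C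
      with ((z * (RtoC 1 + z ^ p * B z)) ^ S p * A (K z) + z ^ S p * B z)%C
      by (rewrite Cpow_mult_l; ring).
    replace (z * (RtoC 1 + z ^ p * B z))%C with (K z) by (unfold K; simpl; ring).
    unfold K at 1. ring.
Qed.

(** For a <> 0 this shows that no positive iterate of F is the identity germ. *)
Lemma has_exp_fiter (p : nat) (F : C -> C) (a : C) (n : nat) : (1 <= p)%nat ->
  has_exp p F a -> has_exp p (fiter n F) (RtoC (INR n) * a)%C.
Proof.
  intros Hp HF. induction n as [|n IH].
  - simpl INR. rewrite Cmult_0_l. apply has_exp_id.
  - rewrite S_INR, RtoC_plus.
    replace ((RtoC (INR n) + RtoC 1) * a)%C with (a + RtoC (INR n) * a)%C by ring.
    apply (has_exp_comp p F (fiter n F)); auto.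
Qed.

Lemma has_exp_unique (p : nat) (F : C -> C) (a b : C) : has_exp p F a -> has_exp p F b -> a = b.
Proof.
  intros (A & HA & <- & H1) (B & HB & <- & H2). apply Ccont_punctured_eq; auto.
  destruct (near0_and _ _ H1 H2) as (r & Hr & H). exists r. split; auto.
  intros z Hz Hz0. destruct (H z Hz) as [E1 E2]. rewrite E1 in E2.
  assert (Hp : (z ^ S p)%C <> RtoC 0) by (apply Cpow_nz; auto).
  replace (A z) with ((z + z ^ S p * A z - z) / z ^ S p)%C by (field; auto).
  rewrite E2. field. auto.
Qed.

(** F (F' z) = z reads F' z = z - (F' z)^(p+1) A (F' z), and F' z = z L z with L 0 = 1 extracts the
    factor z^(p+1). *)
Lemma has_exp_inv (p : nat) (F F' : C -> C) (a : C) :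
  holo_near0 F' -> F' (RtoC 0) = RtoC 0 -> multiplier F' = RtoC 1 -> germ_eq (gcomp F F') idC ->
  has_exp p F a -> has_exp p F' (- a)%C.
Proof.
  intros HF' H0 Hm Hinv (A & HA & Ea & HF).
  destruct (caratheodory0 F' HF') as (L & HL & EL & HFL). rewrite H0 in HFL. rewrite Hm in EL.
  set (K := fun z => (RtoC 0 + z * L z)%C).
  assert (HK : Ccont K (RtoC 0)) by (unfold K; ccont).
  assert (HK0 : K (RtoC 0) = RtoC 0) by (unfold K; simpl; ring).
  exists (fun z => (- RtoC 1)%C * (L z ^ S p * A (K z)))%C. repeat split.
  - ccont. apply (Ccont_comp A K); auto. rewrite HK0; auto.
  - rewrite HK0, Ea, EL, Cpow_1_l. change (@eq C (- RtoC 1 * (RtoC 1 * a)) (- a))%C. ring.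
  - destruct (near0_and _ _ Hinv (near0_and _ _ HFL (near0_comp K _ HK HK0 HF))) as (r & Hr & H).
    exists r. split; auto. intros z Hz. destruct (H z Hz) as (H1 & H2 & H3).
    unfold gcomp, idC in H1. fold (K z) in H2. rewrite H2. rewrite H2, H3 in H1.
    replace (z ^ S p * (- RtoC 1 * (L z ^ S p * A (K z))))%C
      with (- (K z ^ S p * A (K z)))%C.
    + rewrite <- H1 at 2. ring.
    + replace (K z) with (z * L z)%C at 1 by (unfold K; ring). rewrite Cpow_mult_l. ring.
Qed.

(** Both points move, as in the quotient (k (G z) - k z) / (G z - z) of [has_exp_conj]; the
    continuity of k' at 0 makes the estimate uniform. *)
Lemma strict_derivative (k : C -> C) (e : R) : holo_near0 k -> 0 < e ->
  exists r, 0 < r /\ forall z w, Cmod z < r -> Cmod w < r ->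
    Cmod (k w - k z - (w - z) * multiplier k) <= e * Cmod (w - z).
Proof.
  intros Hk He. pose proof (holo_near0_C_derive k Hk) as Hk'.
  destruct (near0_and _ _ Hk Hk') as (r & Hr & H).
  destruct (proj2 (H (RtoC 0) ltac:(rewrite Cmod_0; auto))) as [l Hl].
  destruct (proj1 (Ccont_eps _ _) (is_Cderive_cont _ _ _ Hl) e He) as (s & Hs & Hb).
  set (lam := multiplier k). fold (multiplier k) in Hb. fold lam in Hb.
  exists (Rmin r s). split; [apply Rmin_glb_lt; auto|]. intros z w Hz Hw.
  replace (k w - k z - (w - z) * lam)%C
    with ((fun u => k u - (RtoC 0 + (u - RtoC 0) * lam)) w - (fun u => k u - (RtoC 0 + (u - RtoC 0) * lam)) z)%C
    by (simpl; ring).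
  assert (Hseg : forall t, 0 <= t <= 1 -> Cmod (z + RtoC t * (w - z)) < Rmin r s).
  { intros t Ht. apply segment_in_disc; auto. }
  apply (mean_value_bound (fun u => k u - (RtoC 0 + (u - RtoC 0) * lam))%C (fun u => C_derive k u - lam)%C).
  - intros t Ht. apply (is_Cderive_minus k (fun u => RtoC 0 + (u - RtoC 0) * lam)%C); [|apply is_Cderive_affine].
    apply C_derive_spec, H. eapply Rlt_le_trans; [apply Hseg; auto|apply Rmin_l].
  - intros t Ht. apply (Ccont_minus (C_derive k) (fun _ => lam)); [|apply Ccont_cst]. apply ex_Cderive_cont.
    apply H. eapply Rlt_le_trans; [apply Hseg; auto|apply Rmin_l].
  - intros t Ht. apply Rlt_le, Hb. replace (z + RtoC t * (w - z) - RtoC 0)%C with (z + RtoC t * (w - z))%C by ring.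
    eapply Rlt_le_trans; [apply Hseg; auto|apply Rmin_r].
Qed.

(* Compare the terms in [z^(p+1)] of [F1 (k z) - k z] and [k (F2 z) - k z]. *)
Lemma has_exp_conj (p : nat) (F1 F2 k : C -> C) (a1 a2 : C) :
  inG k -> has_exp p F1 a1 -> has_exp p F2 a2 -> germ_eq (gcomp F1 k) (gcomp k F2) ->
  (multiplier k ^ p * a1 = a2)%C.
Proof.
  intros [Hk [Hk0 Hm]] (A1 & HA1 & E1 & H1) (A2 & HA2 & E2 & H2) Hc.
  set (lam := multiplier k) in *.
  destruct (caratheodory0 k Hk) as (L & HL & EL & HkL). rewrite Hk0 in HkL. fold lam in EL.
  set (K := fun z => (RtoC 0 + z * L z)%C).
  assert (HK : Ccont K (RtoC 0)) by (unfold K; ccont).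
  assert (HK0 : K (RtoC 0) = RtoC 0) by (unfold K; simpl; ring).
  set (G := fun z => (z + z ^ S p * A2 z)%C).
  assert (HG : Ccont G (RtoC 0)) by (unfold G; ccont).
  assert (HG0 : G (RtoC 0) = RtoC 0) by (unfold G; simpl; ring).
  (* At fixed points of [G] the value [lam] preserves both the product formula [HTk] and the
     continuity of [T] at 0. *)
  set (T := fun z => if Ceq_dec (G z) z then lam else ((k (G z) - k z) / (G z - z))%C).
  assert (HT0 : T (RtoC 0) = lam).
  { unfold T. rewrite HG0. destruct (Ceq_dec (RtoC 0) (RtoC 0)); congruence. }
  assert (HTk : forall z, (k (G z) - k z = (G z - z) * T z)%C).
  { intros z. unfold T. destruct (Ceq_dec (G z) z) as [->|Hne]; [ring|].
    field. apply Cminus_eq_contra; auto. }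
  assert (HT : Ccont T (RtoC 0)).
  { apply Ccont_at0. intros e He. destruct (strict_derivative k e Hk He) as (r & Hr & Hb).
    assert (Hn : near0 (fun z => Cmod z < r)) by (exists r; auto).
    destruct (near0_and _ _ Hn (near0_comp G _ HG HG0 Hn)) as (s & Hs & H).
    exists s. split; auto. intros z Hz. destruct (H z Hz) as [Hz1 Hz2].
    rewrite HT0. unfold T. destruct (Ceq_dec (G z) z) as [_|Hne].
    { replace (lam - lam)%C with (RtoC 0) by ring. rewrite Cmod_0; lra. }
    assert (Hd : (G z - z)%C <> RtoC 0) by (apply Cminus_eq_contra; auto).
    assert (Hd' : 0 < Cmod (G z - z)) by (apply Cmod_gt_0; auto).
    replace ((k (G z) - k z) / (G z - z) - lam)%C
      with ((k (G z) - k z - (G z - z) * lam) / (G z - z))%C by (field; auto).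
    rewrite Cmod_div by auto. apply Rmult_le_reg_r with (Cmod (G z - z)); auto.
    unfold Rdiv. rewrite Rmult_assoc, Rinv_l, Rmult_1_r by lra. apply Hb; auto. }
  (* Subtracting k z from both sides of F1 (k z) = k (F2 z), dividing by z^(p+1) and letting z tend
     to 0 gives lam^(p+1) a1 = a2 lam. *)
  assert (E : (L (RtoC 0) ^ S p * A1 (K (RtoC 0)) = A2 (RtoC 0) * T (RtoC 0))%C).
  { apply (Ccont_punctured_eq (fun z => L z ^ S p * A1 (K z))%C (fun z => A2 z * T z)%C).
    - ccont. apply (Ccont_comp A1 K); auto. rewrite HK0; auto.
    - ccont.
    - destruct (near0_and _ _ Hc (near0_and _ _ HkL (near0_and _ _ H2 (near0_comp K _ HK HK0 H1))))
        as (r & Hr & H).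
      exists r. split; auto. intros z Hz Hz0. destruct (H z Hz) as (C1 & C2 & C3 & C4).
      unfold gcomp in C1. rewrite C3 in C1. fold (G z) in C1. fold (K z) in C2.
      specialize (HTk z). rewrite <- C1, C2, C4 in HTk.
      assert (Hp : (z ^ S p)%C <> RtoC 0) by (apply Cpow_nz; auto).
      replace (L z ^ S p * A1 (K z))%C with ((K z + K z ^ S p * A1 (K z) - K z) / z ^ S p)%C.
      + rewrite HTk. unfold G. field. auto.
      + replace (K z ^ S p)%C with (z ^ S p * L z ^ S p)%C
          by (rewrite <- Cpow_mult_l; f_equal; unfold K; ring).
        field. auto. }
  rewrite HK0, EL, E1, E2, HT0 in E.
  replace a2 with (a2 * lam / lam)%C by (field; auto). rewrite <- E. simpl. field. auto.
Qed.

(** * Groups up to an equivalence *)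

(** The laws hold only up to an equivalence, since germs are functions modulo [germ_eq].
    Compatibility of [gopp] with it follows from uniqueness of inverses. *)
Record sgroup := SGroup {
  carrier :> Type;
  geq : carrier -> carrier -> Prop;
  gop : carrier -> carrier -> carrier;
  gone : carrier;
  gopp : carrier -> carrier;
  geq_equiv : Equivalence geq;
  gop_proper : Proper (geq ==> geq ==> geq) gop;
  gopA : forall x y z, geq (gop x (gop y z)) (gop (gop x y) z);
  gop1 : forall x, geq (gop x gone) x;
  g1op : forall x, geq (gop gone x) x;
  gopV : forall x, geq (gop x (gopp x)) gone;
  gVop : forall x, geq (gop (gopp x) x) gone
}.

Arguments geq {_}. Arguments gop {_}. Arguments gone {_}. Arguments gopp {_}.
#[export] Existing Instance geq_equiv.
#[export] Existing Instance gop_proper.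

Declare Scope sgroup_scope.
Local Open Scope sgroup_scope.
Local Infix "==" := geq (at level 70) : sgroup_scope.
Local Infix "**" := gop (at level 40, left associativity) : sgroup_scope.

Section Powers.
Context {G : sgroup}.
Implicit Types x y z a b : G.

Lemma gop_cancel_l x y z : x ** y == x ** z -> y == z.
Proof.
  intros H. rewrite <- (g1op G y), <- (g1op G z), <- (gVop G x), <- !gopA, H. reflexivity.
Qed.

Lemma gop_cancel_r x y z : y ** x == z ** x -> y == z.
Proof.
  intros H. rewrite <- (gop1 G y), <- (gop1 G z), <- (gopV G x), !gopA, H. reflexivity.
Qed.

Lemma gopp_unique x y : x ** y == gone -> y == gopp x.
Proof. intros H. apply (gop_cancel_l x). rewrite H, gopV. reflexivity. Qed.

#[local] Instance gopp_proper : Proper (geq ==> geq) (@gopp G).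
Proof. intros x y H. apply gopp_unique. rewrite <- H. apply gopV. Qed.

Definition npow x (n : nat) : G := Nat.iter n (gop x) gone.
(** The case split is that of [zpow_rel], so that the two can be matched in [zpow_rel_zp]. *)
Definition zp x (n : Z) : G :=
  if Z.leb 0 n then npow x (Z.to_nat n) else npow (gopp x) (Z.to_nat (- n)).

Lemma zp_of_nat x (n : nat) : zp x (Z.of_nat n) = npow x n.
Proof. unfold zp. rewrite (proj2 (Z.leb_le _ _)) by lia. rewrite Nat2Z.id. reflexivity. Qed.

Lemma zp_succ x n : zp x (Z.succ n) == x ** zp x n.
Proof.
  destruct (Z_le_gt_dec 0 n) as [Hn|Hn].
  - rewrite <- (Z2Nat.id n Hn), <- Nat2Z.inj_succ, !zp_of_nat. reflexivity.
  - unfold zp at 2. rewrite (proj2 (Z.leb_gt _ _)) by lia.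
    replace (Z.to_nat (- n)) with (S (Z.to_nat (- Z.succ n))) by lia.
    change (npow (gopp x) (S (Z.to_nat (- Z.succ n))))
      with (gopp x ** npow (gopp x) (Z.to_nat (- Z.succ n))).
    rewrite gopA, gopV, g1op. unfold zp. destruct (Z.leb_spec 0 (Z.succ n)) as [H|H].
    + replace (Z.succ n) with 0%Z by lia. reflexivity.
    + reflexivity.
Qed.

Lemma zp_0 x : zp x 0 == gone.
Proof. reflexivity. Qed.

Lemma zp_1 x : zp x 1 == x.
Proof. change 1%Z with (Z.succ 0). rewrite zp_succ, zp_0. apply gop1. Qed.

(** The step is an equivalence in order to reach negative integers; in a group its backward half
    comes from cancellation. *)
Lemma Z_succ_ind (P : Z -> Prop) :
  P 0%Z -> (forall n, P n <-> P (Z.succ n)) -> forall n, P n.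
Proof. intros H0 HS. apply Z.bi_induction; auto. intros ? ? ->. reflexivity. Qed.

Lemma zp_add x n k : zp x (n + k) == zp x n ** zp x k.
Proof.
  revert n. apply Z_succ_ind.
  - rewrite zp_0, g1op. reflexivity.
  - intros n. rewrite Z.add_succ_l, !zp_succ, <- gopA. split; intros H.
    + rewrite H. reflexivity.
    + apply (gop_cancel_l x). exact H.
Qed.

(** The hypothesis is y^-1 a y = b without inverses: conjugation commutes with powers. *)
Lemma zp_intertwine a b y : a ** y == y ** b -> forall n, zp a n ** y == y ** zp b n.
Proof.
  intros H. apply Z_succ_ind.
  - rewrite !zp_0, gop1, g1op. reflexivity.
  - intros n. rewrite !zp_succ. split; intros Hn.
    + rewrite <- gopA, Hn, !gopA, H. reflexivity.
    + apply (gop_cancel_l a). rewrite !gopA, H, <- !gopA. rewrite <- !gopA in Hn. exact Hn.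
Qed.

Lemma zp_one n : zp (@gone G) n == gone.
Proof.
  revert n. apply Z_succ_ind; [apply zp_0|]. intros n. rewrite zp_succ, g1op. reflexivity.
Qed.

Lemma zp_opp x n : zp x (- n) == gopp (zp x n).
Proof. apply gopp_unique. rewrite <- zp_add, Z.add_opp_diag_r. apply zp_0. Qed.

Lemma zp_mul x n k : zp x (n * k) == zp (zp x n) k.
Proof.
  revert k. apply Z_succ_ind.
  - rewrite Z.mul_0_r. reflexivity.
  - intros k. rewrite Z.mul_succ_r, Z.add_comm, zp_add, zp_succ. split; intros H.
    + rewrite H. reflexivity.
    + apply (gop_cancel_l (zp x n)). exact H.
Qed.

#[local] Instance zp_proper : Proper (geq ==> eq ==> geq) zp.
Proof.
  intros x y H n k <-. revert n. apply Z_succ_ind; [reflexivity|].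
  intros n. rewrite !zp_succ. split; intros Hn.
  - rewrite Hn, H. reflexivity.
  - apply (gop_cancel_l x). rewrite Hn, H. reflexivity.
Qed.

Lemma zp_commute x y n : x ** y == y ** x -> x ** zp y n == zp y n ** x.
Proof. intros H. symmetry. apply zp_intertwine. symmetry. exact H. Qed.

Lemma zp_zp_commute x n k : zp x n ** zp x k == zp x k ** zp x n.
Proof. rewrite <- !zp_add, Z.add_comm. reflexivity. Qed.

Lemma zp_gop x y n : x ** y == y ** x -> zp (x ** y) n == zp x n ** zp y n.
Proof.
  intros H. revert n. apply Z_succ_ind.
  - rewrite !zp_0, g1op. reflexivity.
  - intros n. rewrite !zp_succ.
    assert (E : x ** zp x n ** (y ** zp y n) == x ** y ** (zp x n ** zp y n)).
    { rewrite <- !gopA. rewrite (gopA _ (zp x n) y), (zp_intertwine x x y H n), <- !gopA. reflexivity. }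
    rewrite E. split; intros Hn; [rewrite Hn; reflexivity|].
    apply (gop_cancel_l (x ** y)). exact Hn.
Qed.
End Powers.
#[export] Existing Instance gopp_proper.
#[export] Existing Instance zp_proper.

Lemma Z_least_positive (P : Z -> Prop) :
  (exists n, (0 < n)%Z /\ P n) ->
  exists n, (0 < n)%Z /\ P n /\ forall k, (0 < k < n)%Z -> ~ P k.
Proof.
  intros [n0 [Hn0 HP0]]. apply NNPP. intros Hno.
  assert (H : forall k, (0 <= k)%Z -> (0 < k)%Z -> ~ P k).
  { intros k Hk. revert k Hk. apply (Zlt_0_ind (fun k => (0 < k)%Z -> ~ P k)).
    intros k IH Hk Hkpos HPk. apply Hno. exists k. split; auto. split; auto.
    intros j Hj. apply IH; lia. }
  apply (H n0); auto; lia.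
Qed.

(** A relation stands in for the injection, because decompositions of group elements only exist and
    are not computed; choice selects the images. *)
Lemma pigeonhole_le (a b : nat) (Rel : nat -> nat -> Prop) :
  (forall i, (i < a)%nat -> exists j, (j < b)%nat /\ Rel i j) ->
  (forall i i' j, (i < a)%nat -> (i' < a)%nat -> Rel i j -> Rel i' j -> i = i') ->
  (a <= b)%nat.
Proof.
  intros Htot Hinj.
  assert (Hc : forall i, exists j, (i < a)%nat -> (j < b)%nat /\ Rel i j).
  { intros i. destruct (Nat.lt_ge_cases i a) as [Hi|Hi].
    - destruct (Htot i Hi) as [j Hj]. exists j. auto.
    - exists 0%nat. lia. }
  set (e := fun i => proj1_sig (constructive_indefinite_description _ (Hc i))).
  assert (He : forall i, (i < a)%nat -> (e i < b)%nat /\ Rel i (e i)).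
  { intros i. exact (proj2_sig (constructive_indefinite_description _ (Hc i))). }
  rewrite <- (List.length_seq a 0), <- (List.length_map e), <- (List.length_seq b 0).
  apply List.NoDup_incl_length.
  - assert (Hs : forall i, List.In i (List.seq 0 a) -> (i < a)%nat) by (intros i Hi; apply List.in_seq in Hi; lia).
    revert Hs. generalize (List.seq_NoDup a 0). generalize (List.seq 0 a) as l.
    induction 1 as [|i l Hi Hl IH]; intros Hs; simpl; constructor.
    + intros H. apply List.in_map_iff in H. destruct H as (i' & E & Hi'). apply Hi.
      assert (i = i') as ->; auto. apply (Hinj i i' (e i)).
      * apply Hs; left; auto.
      * apply Hs; right; auto.
      * apply He, Hs; left; auto.
      * rewrite <- E. apply He, Hs; right; auto.
    + apply IH. intros j Hj. apply Hs. right; auto.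
  - intros j Hj. apply List.in_map_iff in Hj. destruct Hj as (i & <- & Hi).
    apply List.in_seq in Hi. apply List.in_seq. destruct (He i); lia.
Qed.

(** * Elements reversing a group element *)

Definition cis (t : R) : C := (cos t, sin t).

Lemma cis_plus (s t : R) : cis (s + t) = (cis s * cis t)%C.
Proof. unfold cis, Cmult; simpl. rewrite cos_plus, sin_plus. f_equal; ring. Qed.

Lemma cis_0 : cis 0 = RtoC 1.
Proof. unfold cis. rewrite cos_0, sin_0. reflexivity. Qed.

Lemma cis_pow (t : R) (n : nat) : (cis t ^ n)%C = cis (INR n * t).
Proof.
  induction n as [|n IH]; [simpl; rewrite Rmult_0_l, cis_0; reflexivity|].
  rewrite Cpow_S, IH, <- cis_plus, S_INR. f_equal. ring.
Qed.

Lemma cis_surj (w : C) : Cmod w = 1 -> exists t, w = cis t.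
Proof.
  destruct w as [x y]. intros H. unfold Cmod in H; simpl in H.
  assert (Hxy : x * x + y * y = 1).
  { replace (x * x + y * y) with (x * (x * 1) + y * (y * 1)) by ring.
    rewrite <- (sqrt_sqrt (x * (x * 1) + y * (y * 1))) by nra. rewrite H. ring. }
  assert (Hx : -1 <= x <= 1) by nra.
  assert (Hs : sqrt (1 - x²) = Rabs y).
  { rewrite <- sqrt_Rsqr_abs. f_equal. unfold Rsqr. lra. }
  destruct (Rle_lt_dec 0 y) as [Hy|Hy].
  - exists (acos x). unfold cis. rewrite cos_acos, sin_acos, Hs by auto.
    rewrite Rabs_right by lra. reflexivity.
  - exists (- acos x). unfold cis. rewrite cos_neg, sin_neg, cos_acos, sin_acos, Hs by auto.
    rewrite Rabs_left, Ropp_involutive by lra. reflexivity.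
Qed.

Lemma root_of_unity_cis (n : nat) (w : C) : (0 < n)%nat -> (w ^ n)%C = RtoC 1 ->
  exists k : Z, w = cis (IZR k * (2 * PI / INR n)).
Proof.
  intros Hn Hw. assert (Hn' : 0 < INR n) by (apply lt_0_INR; auto).
  assert (Hm : Cmod w = 1).
  { assert (E : Cmod w ^ n = 1) by (rewrite <- Cmod_pow, Hw; apply Cmod_1).
    destruct (Rtotal_order (Cmod w) 1) as [H|[H|H]]; auto; exfalso.
    - pose proof (pow_lt_1_compat (Cmod w) n (conj (Cmod_ge_0 w) H) Hn). lra.
    - pose proof (Rlt_pow_R1 (Cmod w) n H Hn). lra. }
  destruct (cis_surj w Hm) as [t ->]. rewrite cis_pow in Hw.
  assert (Hc : cos (INR n * t) = 1) by exact (f_equal fst Hw).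
  (* By 1 - cos (2 u) = 2 (sin u)^2 the half angle is a zero of the sine, hence a multiple of pi. *)
  replace (INR n * t) with (2 * (INR n * t / 2)) in Hc by field.
  rewrite cos_2a_sin in Hc.
  destruct (sin_eq_0_0 (INR n * t / 2)) as [k Hk]; [nra|].
  exists k. f_equal. replace t with (2 * (INR n * t / 2) / INR n) by (field; lra).
  rewrite Hk. field. lra.
Qed.

Section Reversers.
Context {G : sgroup} (m : G -> C).
Hypothesis m_proper : Proper (geq ==> eq) m.
Hypothesis m_op : forall x y : G, m (x ** y) = (m x * m y)%C.
Hypothesis m_one : m gone = RtoC 1.

(* [e = 1]: [x] commutes with [F]; [e = -1]: [x] reverses [F]. *)
Definition twist (F : G) (e : Z) (x : G) : Prop := F ** x == x ** zp F e.

#[local] Instance twist_proper (F : G) (e : Z) : Proper (geq ==> iff) (twist F e).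
Proof. intros x y H. unfold twist. rewrite H. reflexivity. Qed.

Lemma twist_op F e e' x y : twist F e x -> twist F e' y -> twist F (e' * e) (x ** y).
Proof.
  unfold twist. intros Hx Hy. rewrite gopA, Hx, <- gopA, (zp_intertwine F _ y Hy), zp_mul, gopA.
  reflexivity.
Qed.

(** The condition on [e] treats commuting and reversing elements at once. *)
Lemma twist_inv F e x : (e * e = 1)%Z -> twist F e x -> twist F e (gopp x).
Proof.
  unfold twist. intros He Hx. apply (gop_cancel_l x).
  rewrite (gopA _ x (gopp x)), gopV, g1op. apply (gop_cancel_r x).
  rewrite <- !gopA, gVop, gop1.
  rewrite (zp_intertwine F _ x Hx), <- zp_mul, He, zp_1. reflexivity.
Qed.

Lemma twist_one F : twist F 1 gone.
Proof. unfold twist. rewrite gop1, g1op, zp_1. reflexivity. Qed.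

Lemma twist_commute F x : twist F 1 x <-> x ** F == F ** x.
Proof. unfold twist. rewrite zp_1. split; intros H; symmetry; exact H. Qed.

Lemma twist_zp F e x : (e * e = 1)%Z -> twist F e x ->
  forall n, twist F 1 (zp x (2 * n)) /\ twist F e (zp x (2 * n + 1)).
Proof.
  intros He Hx n.
  assert (Heven : twist F 1 (zp x (2 * n))).
  { revert n. apply Z_succ_ind; [apply twist_one|]. intros n.
    assert (Hxx : twist F 1 (zp x 2)).
    { change 2%Z with (Z.succ 1). rewrite zp_succ, zp_1, <- He. apply twist_op; auto. }
    rewrite Z.mul_succ_r, zp_add. split; intros H.
    - exact (twist_op F 1 1 _ _ H Hxx).
    - pose proof (twist_op F 1 1 _ _ H (twist_inv F 1 _ eq_refl Hxx)) as H'.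
      rewrite <- gopA, gopV, gop1 in H'. exact H'. }
  split; auto. rewrite zp_add, zp_1. replace e with (e * 1)%Z by lia. apply twist_op; auto.
Qed.

Lemma m_inv (x : G) : (m x * m (gopp x) = RtoC 1)%C.
Proof. rewrite <- m_op, <- m_one. apply m_proper, gopV. Qed.

Lemma m_neq0 (x : G) : m x <> RtoC 0.
Proof. intros E. pose proof (m_inv x) as H. rewrite E, Cmult_0_l in H. apply C1_nz. auto. Qed.

Lemma m_npow (x : G) (n : nat) : m (zp x (Z.of_nat n)) = (m x ^ n)%C.
Proof.
  rewrite zp_of_nat. induction n as [|n IH]; [exact m_one|].
  change (npow x (S n)) with (x ** npow x n). rewrite m_op, IH. reflexivity.
Qed.

Lemma m_zp_cis (x : G) (t : R) : m x = cis t -> forall n, m (zp x n) = cis (IZR n * t).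
Proof.
  intros Hx. apply Z_succ_ind.
  - rewrite Rmult_0_l, cis_0. exact m_one.
  - intros n. rewrite zp_succ, m_op, succ_IZR, Rmult_plus_distr_r, Rmult_1_l, Rplus_comm, cis_plus, <- Hx.
    split; intros H; [rewrite H; reflexivity|].
    assert (E : (/ m x * (m x * m (zp x n)) = / m x * (m x * cis (IZR n * t)))%C) by (rewrite H; reflexivity).
    rewrite !Cmult_assoc, Cinv_l, !Cmult_1_l in E by apply m_neq0. exact E.
Qed.

(** * Consequences of m(x)^p = 1 or -1 and of the root h of infinite order *)

Context (p : nat) (F h : G) (d : Z).
Hypothesis p_pos : (0 < p)%nat.
Hypothesis m_centr : forall x, twist F 1 x -> (m x ^ p)%C = RtoC 1.
Hypothesis m_rev : forall x, twist F (-1) x -> (m x ^ p)%C = (- RtoC 1)%C.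
Hypothesis F_free : forall n, zp F n == gone -> n = 0%Z.
Hypothesis d_pos : (0 < d)%Z.
Hypothesis h_root : zp h d == F.
Hypothesis h_mult : m h = RtoC 1.
Hypothesis h_gen : forall x, twist F 1 x -> m x = RtoC 1 -> exists n, x == zp h n.

Lemma C1_neq_opp1 : RtoC 1 <> (- RtoC 1)%C.
Proof. intros E. apply (f_equal fst) in E. simpl in E. lra. Qed.

Lemma h_free n : zp h n == gone -> n = 0%Z.
Proof.
  intros H. apply F_free. rewrite <- h_root, <- zp_mul, Z.mul_comm, zp_mul, H. apply zp_one.
Qed.

Lemma zp_h_inj n k : zp h n == zp h k -> n = k.
Proof.
  intros H. assert (E : zp h (n - k) == gone).
  { unfold Z.sub. rewrite zp_add, zp_opp, H. apply gopV. }
  apply h_free in E. lia.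
Qed.

(* [x^-1 h x] centralises [F] and has multiplier 1, so it is a power [h^a]; comparing
   [d]-th powers gives [a = e]. *)
Lemma twist_root e x : (e * e = 1)%Z -> twist F e x -> twist h e x.
Proof.
  intros He Hx. set (y := gopp x ** h ** x).
  assert (Hxi : twist F e (gopp x)) by (apply twist_inv; auto).
  assert (HhF : twist F 1 h).
  { apply twist_commute. rewrite <- h_root. apply zp_commute. reflexivity. }
  destruct (h_gen y) as [a Ha].
  - unfold y. rewrite <- He at 1. replace (e * e)%Z with (e * (1 * e))%Z by lia.
    repeat apply twist_op; auto.
  - unfold y. rewrite !m_op, h_mult, Cmult_1_r, Cmult_comm. apply m_inv.
  - assert (Hxy : h ** x == x ** zp h a).
    { rewrite <- Ha. unfold y. rewrite !gopA, gopV, g1op. reflexivity. }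
    pose proof (zp_intertwine _ _ _ Hxy d) as Hd. rewrite h_root in Hd. unfold twist in Hx.
    rewrite Hx in Hd. apply gop_cancel_l in Hd. rewrite <- h_root, <- !zp_mul in Hd.
    apply zp_h_inj in Hd. assert (a = e) as -> by nia. exact Hxy.
Qed.

Definition ext_centr (x : G) : Prop := twist F 1 x \/ twist F (-1) x.

Lemma ext_centr_op x y : ext_centr x -> ext_centr y -> ext_centr (x ** y).
Proof.
  intros [Hx|Hx] [Hy|Hy]; [left|right|right|left]; exact (twist_op F _ _ x y Hx Hy).
Qed.

Lemma ext_centr_zp x n : ext_centr x -> ext_centr (zp x n).
Proof.
  intros H. pose proof (Z.div_mod n 2 ltac:(lia)) as E. pose proof (Z.mod_pos_bound n 2 ltac:(lia)).
  assert (Hn : (n = 2 * (n / 2) \/ n = 2 * (n / 2) + 1)%Z) by lia.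
  set (k := (n / 2)%Z) in *. clearbody k.
  destruct H as [H|H]; [pose proof (twist_zp F 1 x eq_refl H k) as [H1 H2]
    |pose proof (twist_zp F (-1) x eq_refl H k) as [H1 H2]];
    destruct Hn as [-> | ->]; unfold ext_centr; auto.
Qed.

Lemma ext_centr_m x : ext_centr x -> (m x ^ (2 * p))%C = RtoC 1.
Proof.
  intros H. rewrite Nat.mul_comm, Cpow_mult_r.
  destruct H as [H|H]; [rewrite m_centr by auto|rewrite m_rev by auto]; simpl; ring.
Qed.

(** All multipliers are [cis (a t)] with t = 2 pi / (2 p), and by division with remainder the least
    positive exponent divides all others. Its element g cannot commute with F: its powers would too,
    while some power shares its multiplier with a reverser. *)
Lemma cyclic_multipliers : (exists x, twist F (-1) x) ->
  exists g, twist F (-1) g /\ forall x, ext_centr x -> exists j, m x = m (zp g j).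
Proof.
  intros [g1 Hg1]. set (t := 2 * PI / INR (2 * p)).
  assert (Hp : 0 < INR (2 * p)) by (apply lt_0_INR; lia).
  destruct (Z_least_positive (fun a => exists x, ext_centr x /\ m x = cis (IZR a * t)))
    as (s & Hs & (g & Hg & Hgs) & Hmin).
  (* The neutral element realises the exponent 2 p, so a least positive one exists. *)
  { exists (Z.of_nat (2 * p)). split; [lia|]. exists gone. split; [left; apply twist_one|].
    rewrite <- INR_IZR_INZ. unfold t. replace (INR (2 * p) * (2 * PI / INR (2 * p))) with (2 * PI) by (field; lra).
    unfold cis. rewrite cos_2PI, sin_2PI. exact m_one. }
  assert (Hall : forall x, ext_centr x -> exists j, m x = m (zp g j)).
  { intros x Hx. destruct (root_of_unity_cis (2 * p) (m x) ltac:(lia) (ext_centr_m x Hx)) as [a Ha].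
    fold t in Ha. pose proof (Z.div_mod a s ltac:(lia)) as E. pose proof (Z.mod_pos_bound a s Hs) as Hb.
    set (j := (a / s)%Z) in *.
    assert (Hj : forall k, m (zp g k) = cis (IZR (s * k) * t)).
    { intros k. rewrite (m_zp_cis g _ Hgs), mult_IZR. f_equal. ring. }
    exists j. rewrite Hj, Ha. destruct (Z.eq_dec (a mod s) 0) as [E0|E0].
    - rewrite E, E0, Z.add_0_r. reflexivity.
    - exfalso. apply (Hmin (a mod s)%Z ltac:(lia)). exists (x ** zp g (- j)).
      split; [apply ext_centr_op, ext_centr_zp; auto|].
      rewrite m_op, Hj, Ha, <- cis_plus. f_equal. rewrite <- Rmult_plus_distr_r, <- plus_IZR.
      f_equal. f_equal. lia. }
  exists g. split; auto. destruct Hg as [Hg|Hg]; auto. exfalso.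
  destruct (Hall g1 (or_intror Hg1)) as [j Hj].
  assert (Hc : twist F 1 (zp g j)).
  { apply twist_commute. symmetry. apply zp_commute. symmetry. apply twist_commute. exact Hg. }
  apply C1_neq_opp1. rewrite <- (m_rev _ Hg1), Hj. symmetry. apply m_centr. exact Hc.
Qed.

(** * Normal form relative to a reverser whose multiplier generates *)

Context (g : G).
Hypothesis g_rev : twist F (-1) g.
Hypothesis g_gen : forall x, ext_centr x -> exists j, m x = m (zp g j).

Lemma zp_g_even j : twist F 1 (zp g (2 * j)).
Proof. apply (twist_zp F (-1) g eq_refl g_rev). Qed.

Lemma zp_g_odd j : twist F (-1) (zp g (2 * j + 1)).
Proof. apply (twist_zp F (-1) g eq_refl g_rev). Qed.

Lemma m_centr_not_rev x : twist F 1 x -> twist F (-1) x -> False.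
Proof. intros H1 H2. apply C1_neq_opp1. rewrite <- (m_rev x H2). symmetry. auto. Qed.

(** Dividing x by a power of g with the same multiplier leaves multiplier 1. That excludes a
    reverser, so the quotient centralises F and is a power of h. *)
Lemma ext_centr_decomp x : ext_centr x -> exists l c, x == zp g l ** zp h c.
Proof.
  intros Hx. destruct (g_gen x Hx) as [l Hl]. exists l.
  assert (Hy : ext_centr (zp g (- l) ** x)) by (apply ext_centr_op; auto; apply ext_centr_zp; right; auto).
  assert (Hm : m (zp g (- l) ** x) = RtoC 1).
  { rewrite m_op, Hl, <- m_op, <- m_one. apply m_proper. rewrite <- zp_add, Z.add_opp_diag_l. apply zp_0. }
  assert (Hy1 : twist F 1 (zp g (- l) ** x)).
  { destruct Hy as [Hy|Hy]; auto. exfalso. pose proof (m_rev _ Hy) as E. rewrite Hm, Cpow_1_l in E.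
    exact (C1_neq_opp1 E). }
  destruct (h_gen _ Hy1 Hm) as [c Hc]. exists c. rewrite <- Hc, gopA, <- zp_add, Z.add_opp_diag_r, zp_0, g1op.
  reflexivity.
Qed.

Lemma zp_h_centr c : twist F 1 (zp h c).
Proof.
  apply twist_commute. symmetry. apply zp_commute. rewrite <- h_root. symmetry. apply zp_commute. reflexivity.
Qed.

Lemma centr_decomp x : twist F 1 x -> exists j c, x == zp g (2 * j) ** zp h c.
Proof.
  intros Hx. destruct (ext_centr_decomp x (or_introl Hx)) as (l & c & E).
  destruct (Z.Even_or_Odd l) as [[j ->]|[j ->]]; [exists j, c; exact E|exfalso].
  apply (m_centr_not_rev x Hx). rewrite E. exact (twist_op F _ _ _ _ (zp_g_odd j) (zp_h_centr c)).
Qed.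

Lemma rev_decomp x : twist F (-1) x -> exists j c, x == zp g (2 * j + 1) ** zp h c.
Proof.
  intros Hx. destruct (ext_centr_decomp x (or_intror Hx)) as (l & c & E).
  destruct (Z.Even_or_Odd l) as [[j ->]|[j ->]]; [exfalso|exists j, c; exact E].
  refine (m_centr_not_rev x _ Hx). rewrite E. exact (twist_op F _ _ _ _ (zp_g_even j) (zp_h_centr c)).
Qed.

(* A power of [g] with multiplier 1 is a power [h^c] commuting with [g], while [g] inverts [h]. *)
Lemma zp_g_m1 j : m (zp g (2 * j)) = RtoC 1 -> zp g (2 * j) == gone.
Proof.
  intros Hm. destruct (h_gen _ (zp_g_even j) Hm) as [c Hc].
  pose proof (zp_intertwine _ _ _ (twist_root (-1) g eq_refl g_rev) c) as H1.
  rewrite <- zp_mul, <- Hc in H1. rewrite <- (zp_commute g g (2 * j)) in H1 by reflexivity.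
  apply gop_cancel_l in H1. rewrite Hc in H1. apply zp_h_inj in H1.
  rewrite Hc. replace c with 0%Z by lia. apply zp_0.
Qed.

(** The odd power of g inverts h, so moving h^c across it gives h^(-c), which cancels the other
    h^c. *)
Lemma rev_square x j c : x == zp g (2 * j + 1) ** zp h c -> x ** x == zp g (2 * (2 * j + 1)).
Proof.
  intros E. rewrite E.
  pose proof (zp_intertwine _ _ _ (twist_root (-1) _ eq_refl (zp_g_odd j)) c) as H.
  rewrite <- gopA, (gopA _ (zp h c)), H, <- gopA, <- zp_mul, <- zp_add.
  replace (-1 * c + c)%Z with 0%Z by lia. rewrite zp_0, gop1, <- zp_add.
  replace (2 * j + 1 + (2 * j + 1))%Z with (2 * (2 * j + 1))%Z by lia. reflexivity.
Qed.

Lemma order_of_square : exists N, (0 < N)%Z /\ forall a, zp g (2 * a) == gone <-> (N | a)%Z.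
Proof.
  destruct (Z_least_positive (fun a => zp g (2 * a) == gone)) as (N & HN & HN1 & Hmin).
  (* m(g)^(2 p) = 1, so g^(2 p) is already trivial. *)
  { exists (Z.of_nat p). split; [lia|]. apply zp_g_m1.
    replace (2 * Z.of_nat p)%Z with (Z.of_nat (2 * p)) by lia. rewrite m_npow.
    apply ext_centr_m. right. exact g_rev. }
  exists N. split; auto. intros a. split.
  - intros Ha. apply Z.mod_divide; [lia|]. pose proof (Z.mod_pos_bound a N HN).
    destruct (Z.eq_dec (a mod N) 0) as [|Hne]; auto. exfalso. apply (Hmin (a mod N)%Z ltac:(lia)).
    replace (2 * (a mod N))%Z with (2 * a + (2 * N) * - (a / N))%Z
      by (pose proof (Z.div_mod a N ltac:(lia)); lia).
    rewrite zp_add, Ha, zp_mul, HN1, zp_one. apply g1op.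
  - intros [k ->]. replace (2 * (k * N))%Z with (2 * N * k)%Z by lia. rewrite zp_mul, HN1. apply zp_one.
Qed.

Context (N : Z).
Hypothesis N_pos : (0 < N)%Z.
Hypothesis N_order : forall a, zp g (2 * a) == gone <-> (N | a)%Z.

Lemma rev_zp_one x a : twist F (-1) x -> zp x a == gone -> Z.Even a.
Proof.
  intros Hx Ha. destruct (Z.Even_or_Odd a) as [|[b ->]]; auto. exfalso.
  pose proof (proj2 (twist_zp F (-1) x eq_refl Hx b)) as H. rewrite Ha in H.
  exact (m_centr_not_rev _ (twist_one F) H).
Qed.

Lemma zp_g_one a : zp g a == gone <-> (2 * N | a)%Z.
Proof.
  split.
  - intros H. destruct (rev_zp_one g a g_rev H) as [b ->]. apply N_order in H.
    apply Z.mul_divide_mono_l. exact H.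
  - intros [k ->]. replace (k * (2 * N))%Z with (2 * (k * N))%Z by lia. apply N_order. exists k; reflexivity.
Qed.

Lemma zp_g_eq a b : zp g (2 * a) == zp g (2 * b) <-> (N | a - b)%Z.
Proof.
  rewrite <- N_order. replace (2 * (a - b))%Z with (2 * a + - (2 * b))%Z by lia.
  rewrite zp_add, zp_opp. split; intros H.
  - rewrite H. apply gopV.
  - apply (gop_cancel_r (gopp (zp g (2 * b)))). rewrite H, gopV. reflexivity.
Qed.

(** If p / N were even, 2 N would divide p and g^p would be trivial, against m(g)^p = -1. *)
Lemma N_divides_p : exists t, Z.of_nat p = (N * t)%Z /\ Z.Odd t.
Proof.
  assert (H : (N | Z.of_nat p)%Z).
  { apply N_order, zp_g_m1. replace (2 * Z.of_nat p)%Z with (Z.of_nat (2 * p)) by lia.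
    rewrite m_npow. apply ext_centr_m. right. exact g_rev. }
  destruct H as [t Ht]. exists t. split; [lia|]. destruct (Z.Even_or_Odd t) as [[b ->]|]; auto.
  exfalso. assert (E : zp g (Z.of_nat p) == gone) by (apply zp_g_one; exists b; lia).
  apply m_proper in E. rewrite m_npow, (m_rev g g_rev), m_one in E. symmetry in E. exact (C1_neq_opp1 E).
Qed.

(** The given representatives are matched with g^0, g^2, ..., g^(2 (N - 1)) by two pigeonhole
    arguments: each c_i lies in the coset of one of these powers, and two of these powers in one
    coset have equal multipliers, hence agree by [zp_g_m1]. *)
Lemma index_eq_N (q : nat) (c : nat -> G) :
  (forall i, (i < q)%nat -> twist F 1 (c i)) ->
  (forall i j, (i < q)%nat -> (j < q)%nat ->
     (exists k, twist F 1 k /\ m k = RtoC 1 /\ c j == c i ** k) -> i = j) ->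
  (forall x, twist F 1 x -> exists i, (i < q)%nat /\
     exists k, twist F 1 k /\ m k = RtoC 1 /\ x == c i ** k) ->
  Z.of_nat q = N.
Proof.
  intros Hc Hinj Hsurj.
  set (Rel := fun (i j : nat) => exists k, c i == zp g (2 * Z.of_nat j) ** zp h k).
  assert (Hm : forall k, m (zp h k) = RtoC 1).
  { intros k. rewrite (m_zp_cis h 0) by (rewrite cis_0; exact h_mult).
    rewrite Rmult_0_r. apply cis_0. }
  assert (Hle : (q <= Z.to_nat N)%nat).
  { apply (pigeonhole_le q (Z.to_nat N) Rel).
    - intros i Hi. destruct (centr_decomp _ (Hc i Hi)) as (j & k & E).
      pose proof (Z.mod_pos_bound j N N_pos). exists (Z.to_nat (j mod N)). split; [lia|].
      exists k. rewrite E, Z2Nat.id by lia.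
      assert (Ej : zp g (2 * j) == zp g (2 * (j mod N))).
      { apply zp_g_eq. exists (j / N)%Z. pose proof (Z.div_mod j N ltac:(lia)). lia. }
      rewrite Ej. reflexivity.
    - intros i i' j Hi Hi' [k E] [k' E']. apply Hinj; auto. exists (zp h (k' - k)).
      split; [apply zp_h_centr|]. split; [apply Hm|].
      rewrite E, E', <- gopA, <- zp_add. replace (k + (k' - k))%Z with k' by lia. reflexivity. }
  assert (Hge : (Z.to_nat N <= q)%nat).
  { apply (pigeonhole_le (Z.to_nat N) q
      (fun j i => exists k, m k = RtoC 1 /\ zp g (2 * Z.of_nat j) == c i ** k)).
    - intros j Hj. destruct (Hsurj _ (zp_g_even (Z.of_nat j))) as (i & Hi & k & _ & Hk & E).
      exists i. split; auto. exists k. auto.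
    - intros j j' i Hj Hj' (k & Hk & E) (k' & Hk' & E').
      assert (D : (N | Z.of_nat j - Z.of_nat j')%Z).
      { apply N_order, zp_g_m1. replace (2 * (Z.of_nat j - Z.of_nat j'))%Z
          with (2 * Z.of_nat j + - (2 * Z.of_nat j'))%Z by lia.
        rewrite zp_add, zp_opp, m_op.
        apply m_proper in E. apply m_proper in E'. rewrite m_op, Hk, Cmult_1_r in E.
        rewrite m_op, Hk', Cmult_1_r in E'. rewrite E, <- E'. apply m_inv. }
      destruct D as [b Hb]. assert (b = 0)%Z by nia. subst b. lia. }
  lia.
Qed.

(** * The torsion generator, squares and orders of reversers *)

Context (omega : G) (delta : Z).
Hypothesis omega_centr : twist F 1 omega.
Hypothesis delta_pos : (0 < delta)%Z.
Hypothesis omega_delta : zp omega delta == gone.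
Hypothesis omega_min : forall k, (0 < k < delta)%Z -> ~ zp omega k == gone.
Hypothesis omega_gen : forall x, twist F 1 x -> (exists n, (0 < n)%Z /\ zp x n == gone) ->
  exists k, x == zp omega k.

(** In omega = g^(2 j) h^c the factors commute. The power N delta kills omega and g^(2 j), so h^(c N
    delta) = 1 and c = 0. *)
Lemma omega_power_of_g : exists j, omega == zp g (2 * j).
Proof.
  destruct (centr_decomp omega omega_centr) as (j & c & E). exists j.
  assert (Hcomm : zp g (2 * j) ** zp h c == zp h c ** zp g (2 * j)).
  { apply zp_commute. apply twist_commute. apply twist_root; auto. apply zp_g_even. }
  assert (H : zp omega (N * delta) == gone).
  { rewrite Z.mul_comm, zp_mul, omega_delta. apply zp_one. }
  rewrite E, zp_gop in H by exact Hcomm.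
  rewrite <- !zp_mul in H.
  replace (2 * j * (N * delta))%Z with (2 * (j * delta * N))%Z in H by lia.
  rewrite (proj2 (N_order (j * delta * N)%Z)) in H by (eexists; reflexivity).
  rewrite g1op in H. apply h_free in H. assert (c = 0)%Z as -> by nia.
  rewrite E, zp_0. apply gop1.
Qed.

Lemma g_power_of_omega : exists k, zp g 2 == zp omega k.
Proof.
  apply omega_gen; [apply (zp_g_even 1)|]. exists N. split; auto.
  rewrite <- zp_mul. apply N_order, Z.divide_refl.
Qed.

(** omega and g^2 are powers of each other, so their orders divide each other. *)
Lemma delta_eq_N : delta = N.
Proof.
  destruct omega_power_of_g as [j Hj]. destruct g_power_of_omega as [k Hk].
  assert (H1 : zp omega N == gone).
  { rewrite Hj, <- zp_mul. replace (2 * j * N)%Z with (2 * (j * N))%Z by lia.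
    apply N_order. eexists; reflexivity. }
  assert (H2 : (N | delta)%Z).
  { apply N_order. rewrite zp_mul, Hk, <- zp_mul, Z.mul_comm, zp_mul, omega_delta. apply zp_one. }
  apply Z.divide_pos_le in H2; auto.
  destruct (Z.eq_dec N delta) as [|Hne]; auto. exfalso. apply (omega_min N); auto. lia.
Qed.

Lemma rev_commutes_omega x : twist F (-1) x -> x ** omega == omega ** x.
Proof.
  intros Hx. destruct omega_power_of_g as [j Hj]. destruct (rev_decomp x Hx) as (l & c & E).
  rewrite Hj, E.
  assert (Hcomm : zp h c ** zp g (2 * j) == zp g (2 * j) ** zp h c).
  { symmetry. apply zp_commute. apply twist_commute. apply twist_root; auto. apply zp_g_even. }
  rewrite <- gopA, Hcomm, !gopA, (zp_zp_commute g). reflexivity.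
Qed.

(* If [N] is even these exponents are odd anyway; if [N] is odd, add [N]. *)
Lemma odd_exponents : exists j k, Z.Odd j /\ Z.Odd k /\
  omega == zp g (2 * j) /\ zp g 2 == zp omega k.
Proof.
  destruct omega_power_of_g as [j Hj]. destruct g_power_of_omega as [k Hk].
  (* Passing from g^2 to omega and back gives j k = 1 modulo N, which forces j and k to be odd when
     N is even. *)
  assert (Hjk : (N | j * k - 1)%Z).
  { apply zp_g_eq. rewrite Z.mul_1_r, Hk, Hj, <- zp_mul. replace (2 * j * k)%Z with (2 * (j * k))%Z by lia.
    reflexivity. }
  assert (Hfix : forall i, Z.Odd i \/ (Z.Odd N /\ Z.Even i) ->
     exists i', Z.Odd i' /\ (N | i - i')%Z).
  { intros i [Hi|[[a Ha] [b Hb]]].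
    - exists i. split; auto. exists 0%Z. lia.
    - exists (i + N)%Z. split; [exists (a + b)%Z; lia|]. exists (-1)%Z. lia. }
  assert (Hpar : forall i i', (N | i * i' - 1)%Z -> Z.Odd i \/ (Z.Odd N /\ Z.Even i)).
  { intros i i' [t Ht]. destruct (Z.Even_or_Odd i) as [Hi|Hi]; auto. right. split; auto.
    destruct (Z.Even_or_Odd N) as [[a Ha]|]; auto. destruct Hi as [b Hb]. exfalso. subst. lia. }
  destruct (Hfix j (Hpar j k Hjk)) as (j' & Hj' & Dj).
  destruct (Hfix k (Hpar k j ltac:(rewrite Z.mul_comm; exact Hjk))) as (k' & Hk' & Dk).
  exists j', k'. repeat split; auto.
  - rewrite Hj. apply zp_g_eq. exact Dj.
  - rewrite Hk, Hj, <- !zp_mul, <- !Z.mul_assoc. apply zp_g_eq.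
    rewrite <- Z.mul_sub_distr_l. apply Z.divide_mul_r. exact Dk.
Qed.

Lemma rev_square_omega x : twist F (-1) x -> exists l, Z.Odd l /\ x ** x == zp omega l.
Proof.
  intros Hx. destruct (rev_decomp x Hx) as (j & c & E).
  destruct odd_exponents as (_ & k & _ & Hk & _ & Ek).
  exists (k * (2 * j + 1))%Z. split.
  - destruct Hk as [b ->]. exists (2 * b * j + b + j)%Z. lia.
  - rewrite (rev_square x j c E), zp_mul, Ek, <- zp_mul. reflexivity.
Qed.

Lemma omega_odd_power l : Z.Odd l -> exists x, twist F (-1) x /\ x ** x == zp omega l.
Proof.
  intros [b Hb]. destruct odd_exponents as (j & _ & [a Ha] & _ & Ej & _).
  (* With j = 2 a + 1 and l = 2 b + 1 this makes 2 i + 1 = j l, so g^(2 i + 1) squares to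
     omega^l. *)
  set (i := (2 * a * b + a + b)%Z).
  exists (zp g (2 * i + 1)). split; [apply zp_g_odd|].
  rewrite (rev_square _ i 0) by (rewrite zp_0, gop1; reflexivity).
  rewrite Ej, <- zp_mul. replace (2 * (2 * i + 1))%Z with (2 * j * l)%Z by (unfold i; subst; lia).
  reflexivity.
Qed.

(** x^2 = g^(2 l) with l odd has order r = N / gcd(N, l), and only even powers of x can be trivial,
    so x has order 2 r. The cofactor s = gcd(N, l) is odd because it divides l. *)
Lemma rev_order x : twist F (-1) x -> exists r s, (0 < r)%Z /\ N = (r * s)%Z /\ Z.Odd s /\
  forall a, zp x a == gone <-> (2 * r | a)%Z.
Proof.
  intros Hx. destruct (rev_decomp x Hx) as (j & c & E). set (l := (2 * j + 1)%Z).
  pose proof (rev_square x j c E) as Hsq. fold l in Hsq.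
  set (s := Z.gcd N l). destruct (Z.gcd_divide_l N l) as [r Hr]. destruct (Z.gcd_divide_r N l) as [l' Hl'].
  fold s in Hr, Hl'. assert (Hs : (0 < s)%Z).
  { pose proof (Z.gcd_nonneg N l). fold s in H. assert (s <> 0%Z); [|lia]. intros E0. rewrite E0 in Hr. lia. }
  assert (Hrpos : (0 < r)%Z) by nia.
  exists r, s. repeat split; auto.
  - destruct (Z.Even_or_Odd s) as [[b Hb]|]; auto. exfalso. unfold l in Hl'. rewrite Hb in Hl'. lia.
  - intros Ha. destruct (rev_zp_one x a Hx Ha) as [b ->].
    rewrite zp_mul in Ha. change 2%Z with (Z.succ 1) in Ha at 1. rewrite zp_succ, zp_1, Hsq, <- zp_mul in Ha.
    rewrite <- Z.mul_assoc in Ha. apply N_order in Ha. apply Z.mul_divide_mono_l.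
    rewrite Hr, Hl' in Ha. replace (l' * s * b)%Z with (l' * b * s)%Z in Ha by lia.
    apply Z.mul_divide_cancel_r in Ha; [|lia].
    (* [r] and [l'] are coprime, being [N] and [l] divided by their gcd. *)
    apply Z.gauss with l'; auto.
    assert (Hg : Z.gcd (r * s) (l' * s) = s) by (rewrite <- Hr, <- Hl'; reflexivity).
    rewrite Z.gcd_mul_mono_r, Z.abs_eq in Hg by lia. nia.
  - intros [b ->]. replace (b * (2 * r))%Z with (2 * (r * b))%Z by lia. rewrite zp_mul.
    change 2%Z with (Z.succ 1) at 1. rewrite zp_succ, zp_1, Hsq, <- zp_mul, <- Z.mul_assoc.
    apply N_order. rewrite Hr, Hl'. exists (l' * b)%Z. lia.
Qed.

(** g has order 2 N = 2 r s, and its odd power g^s is still a reverser. *)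
Lemma rev_with_order r s : N = (r * s)%Z -> Z.Odd s ->
  exists x, twist F (-1) x /\ forall a, zp x a == gone <-> (2 * r | a)%Z.
Proof.
  intros HN [b Hb]. exists (zp g s). split; [rewrite Hb; apply zp_g_odd|].
  intros a. rewrite <- zp_mul, zp_g_one, HN. replace (2 * (r * s))%Z with (s * (2 * r))%Z by lia.
  apply Z.mul_divide_cancel_l. lia.
Qed.

End Reversers.

(** * The group of invertible germs *)

#[export] Instance germ_eq_equiv : Equivalence germ_eq.
Proof.
  split.
  - intros f. exists 1. split; [lra|reflexivity].
  - intros f g (r & Hr & H). exists r. split; auto. intros z Hz. symmetry. auto.
  - intros f g k Hfg Hgk. destruct (near0_and _ _ Hfg Hgk) as (r & Hr & H).
    exists r. split; auto. intros z Hz. destruct (H z Hz) as [-> ->]. reflexivity.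
Qed.

Lemma inG_cont (f : C -> C) : inG f -> Ccont f (RtoC 0).
Proof.
  intros [(r & Hr & Hf) _]. apply ex_Cderive_cont, Hf. rewrite Cmod_0. auto.
Qed.

Lemma inG_derive (f : C -> C) : inG f -> is_Cderive f (RtoC 0) (multiplier f).
Proof.
  intros [(r & Hr & Hf) _]. apply C_derive_spec, Hf. rewrite Cmod_0. auto.
Qed.

Lemma germ_eq_comp_l (f g g' : C -> C) : germ_eq g g' -> germ_eq (gcomp f g) (gcomp f g').
Proof.
  intros (r & Hr & H). exists r. split; auto. intros z Hz. unfold gcomp. rewrite H by auto. reflexivity.
Qed.

Lemma germ_eq_comp_r (f f' g : C -> C) : inG g -> germ_eq f f' -> germ_eq (gcomp f g) (gcomp f' g).
Proof.
  intros Hg H. apply (near0_comp g (fun z => f z = f' z)); auto; [apply inG_cont; auto|apply Hg].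
Qed.

Lemma germ_eq_multiplier (f g : C -> C) : inG f -> germ_eq f g -> multiplier g = multiplier f.
Proof.
  intros Hf (r & Hr & H). apply C_derive_eq. apply (is_Cderive_ext_loc f g _ _ r); auto.
  - intros w Hw. apply H. replace (w - RtoC 0)%C with w in Hw by ring. auto.
  - apply inG_derive; auto.
Qed.

Lemma multiplier_idC : multiplier idC = RtoC 1.
Proof. apply C_derive_eq, is_Cderive_id. Qed.

Lemma inG_idC : inG idC.
Proof.
  repeat split.
  - exists 1. split; [lra|]. intros z _. eexists. apply is_Cderive_id.
  - rewrite multiplier_idC. apply C1_nz.
Qed.

Lemma multiplier_gcomp (f g : C -> C) :
  inG f -> inG g -> multiplier (gcomp f g) = (multiplier f * multiplier g)%C.
Proof.
  intros Hf Hg. apply C_derive_eq. rewrite Cmult_comm. apply (is_Cderive_comp f g).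
  - rewrite (proj1 (proj2 Hg)). apply inG_derive; auto.
  - apply inG_derive; auto.
Qed.

Lemma inG_gcomp (f g : C -> C) : inG f -> inG g -> inG (gcomp f g).
Proof.
  intros Hf Hg. pose proof Hf as [Hfh [Hf0 Hfm]]. pose proof Hg as [Hgh [Hg0 Hgm]]. repeat split.
  - destruct (near0_and _ _ Hgh (near0_comp g _ (inG_cont g Hg) Hg0 Hfh)) as (r & Hr & H).
    exists r. split; auto. intros z Hz. destruct (H z Hz) as [[l Hl] [l' Hl']].
    eexists. apply (is_Cderive_comp f g); eauto.
  - unfold gcomp. rewrite Hg0. auto.
  - rewrite multiplier_gcomp by auto. apply Cmult_neq_0; auto.
Qed.

(** The inverse is part of the data, since [inG] by itself exhibits none. *)
Record igerm := IGerm {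
  ig :> C -> C;
  igV : C -> C;
  ig_inG : inG ig;
  ig_ginv : ginv ig igV
}.

Definition igerm_eq (x y : igerm) : Prop := germ_eq x y.

Definition igerm_one : igerm.
Proof.
  refine (IGerm idC idC inG_idC _). split; [apply inG_idC|]. split; reflexivity.
Defined.

Definition igerm_opp (x : igerm) : igerm.
Proof.
  refine (IGerm (igV x) (ig x) (proj1 (ig_ginv x)) _).
  split; [apply ig_inG|]. split; apply (ig_ginv x).
Defined.

Lemma ginv_gcomp (f f' g g' : C -> C) :
  inG f -> inG g -> ginv f f' -> ginv g g' -> ginv (gcomp f g) (gcomp g' f').
Proof.
  intros Hf Hg (Hf' & F1 & F2) (Hg' & G1 & G2).
  split; [apply inG_gcomp; auto|]. split.
  - transitivity (gcomp f f'); auto.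
    apply (germ_eq_comp_l f (gcomp (gcomp g g') f') f').
    apply (germ_eq_comp_r (gcomp g g') idC f'); auto.
  - transitivity (gcomp g' g); auto.
    apply (germ_eq_comp_l g' (gcomp (gcomp f' f) g) g).
    apply (germ_eq_comp_r (gcomp f' f) idC g); auto.
Qed.

Definition igerm_op (x y : igerm) : igerm :=
  IGerm (gcomp x y) (gcomp (igV y) (igV x)) (inG_gcomp x y (ig_inG x) (ig_inG y))
    (ginv_gcomp _ _ _ _ (ig_inG x) (ig_inG y) (ig_ginv x) (ig_ginv y)).

Definition germs : sgroup.
Proof.
  refine (SGroup igerm igerm_eq igerm_op igerm_one igerm_opp _ _ _ _ _ _ _).
  - split.
    + intros x. unfold igerm_eq. reflexivity.
    + intros x y H. unfold igerm_eq in *. symmetry. auto.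
    + intros x y z H1 H2. unfold igerm_eq in *. etransitivity; eauto.
  - intros x x' Hx y y' Hy. unfold igerm_eq in *. simpl.
    transitivity (gcomp x y'); [apply germ_eq_comp_l; auto|apply germ_eq_comp_r; auto; apply ig_inG].
  - intros x y z. unfold igerm_eq; simpl. reflexivity.
  - intros x. unfold igerm_eq; simpl. reflexivity.
  - intros x. unfold igerm_eq; simpl. reflexivity.
  - intros x. apply (ig_ginv x).
  - intros x. apply (ig_ginv x).
Defined.

Definition germ_mult (x : germs) : C := multiplier (ig x).

Lemma germ_mult_proper : Proper (geq ==> eq) germ_mult.
Proof. intros x y H. symmetry. apply germ_eq_multiplier; [apply ig_inG|exact H]. Qed.

Lemma germ_mult_op (x y : germs) : germ_mult (x ** y) = (germ_mult x * germ_mult y)%C.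
Proof. apply multiplier_gcomp; apply ig_inG. Qed.

Lemma germ_mult_one : germ_mult gone = RtoC 1.
Proof. exact multiplier_idC. Qed.

Lemma ig_npow (x : germs) (n : nat) : ig (npow x n) = fiter n (ig x).
Proof. induction n as [|n IH]; [reflexivity|]. simpl. rewrite IH. reflexivity. Qed.

Lemma zpow_rel_zp (x : germs) (n : Z) (F : C -> C) :
  zpow_rel (ig x) n F <-> germ_eq F (ig (zp x n)).
Proof.
  unfold zpow_rel, zp. destruct (Z.leb 0 n).
  - rewrite ig_npow. reflexivity.
  - set (k := Z.to_nat (- n)). split.
    + intros (f' & Hf' & HF). rewrite HF.
      assert (Hx : ginv f' (ig x)) by (split; [apply ig_inG|split; apply Hf']).
      (* The inverse chosen by [zpow_rel] becomes a group element, so that uniqueness identifies it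
         with the stored one. *)
      set (y := IGerm f' (ig x) (proj1 Hf') Hx : germs).
      assert (Hy : y == gopp x) by (apply gopp_unique, Hf').
      rewrite <- (ig_npow y k : _ = fiter k f'). change (npow y k == npow (gopp x) k).
      rewrite <- !zp_of_nat, Hy. reflexivity.
    + intros HF. exists (igV x). split; [apply ig_ginv|]. rewrite HF, ig_npow. reflexivity.
Qed.

Lemma reverses_twist (F x : germs) : reverses (ig x) (ig F) <-> twist F (-1) x.
Proof.
  assert (E : zp F (-1) == gopp F) by (rewrite (zp_opp F 1), zp_1; reflexivity).
  unfold twist. rewrite E. split.
  - intros (g' & f' & Hg & Hf & H).
    assert (Hg' : ginv g' (ig x)) by (split; [apply ig_inG|split; apply Hg]).
    assert (Hf' : ginv f' (ig F)) by (split; [apply ig_inG|split; apply Hf]).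
    set (X' := IGerm g' (ig x) (proj1 Hg) Hg' : germs).
    set (F' := IGerm f' (ig F) (proj1 Hf) Hf' : germs).
    assert (EX : X' == gopp x) by (apply gopp_unique, Hg).
    assert (EF : F' == gopp F) by (apply gopp_unique, Hf).
    assert (H' : X' ** (F ** x) == F') by exact H.
    rewrite EX, EF in H'. rewrite <- H', gopA, gopV, g1op. reflexivity.
  - intros H. exists (igV x), (igV F). split; [apply ig_ginv|]. split; [apply ig_ginv|].
    change (gopp x ** (F ** x) == gopp F). rewrite H, gopA, gVop, g1op. reflexivity.
Qed.

(** [reverses] provides the inverse that an [igerm] must carry. *)
Lemma reverser_igerm (F : germs) (g : C -> C) :
  reverser (ig F) g -> exists x : germs, ig x = g /\ twist F (-1) x.
Proof.
  intros [Hg Hr]. pose proof Hr as (g' & f' & Hg' & _).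
  exists (IGerm g g' Hg Hg' : germs). split; [reflexivity|]. apply reverses_twist. exact Hr.
Qed.

Lemma igerm_reverser (F x : germs) : twist F (-1) x -> reverser (ig F) (ig x).
Proof. intros H. split; [apply ig_inG|apply reverses_twist; exact H]. Qed.

Lemma gcommute_twist (F x : germs) : gcommute (ig x) (ig F) <-> twist F 1 x.
Proof. rewrite twist_commute. reflexivity. Qed.

(** * Iterates and the invertibility of germs *)

Lemma fiter_succ_r (n : nat) (k : C -> C) (z : C) : fiter (S n) k z = fiter n k (k z).
Proof.
  induction n as [|n IH]; [reflexivity|].
  change (k (fiter (S n) k z) = k (fiter n k (k z))). rewrite IH. reflexivity.
Qed.

Lemma inG_fiter (n : nat) (k : C -> C) : inG k -> inG (fiter n k).
Proof.
  intros Hk. induction n as [|n IH]; [apply inG_idC|]. apply (inG_gcomp k (fiter n k)); auto.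
Qed.

Lemma multiplier_fiter (n : nat) (k : C -> C) :
  inG k -> multiplier (fiter n k) = (multiplier k ^ n)%C.
Proof.
  intros Hk. induction n as [|n IH]; [apply multiplier_idC|].
  change (fiter (S n) k) with (gcomp k (fiter n k)).
  rewrite multiplier_gcomp, IH by (auto; apply inG_fiter; auto). reflexivity.
Qed.

Lemma gcommute_fiter (n : nat) (k f : C -> C) :
  inG k -> inG f -> gcommute k f -> gcommute (fiter n k) f.
Proof.
  intros Hk Hf H. unfold gcommute in *. induction n as [|n IH]; [reflexivity|].
  change (germ_eq (gcomp k (gcomp (fiter n k) f)) (gcomp (gcomp f k) (fiter n k))).
  rewrite (germ_eq_comp_l k _ _ IH). symmetry.
  apply (germ_eq_comp_r (gcomp f k) (gcomp k f) (fiter n k)).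
  - apply inG_fiter; auto.
  - symmetry. exact H.
Qed.

(** k^n s is a right inverse of k and s k^n a left one, so they agree as germs. This makes h and the
    germs commuting with f invertible. *)
Lemma ginv_of_fiter (n : nat) (k s : C -> C) :
  inG k -> ginv (fiter (S n) k) s -> exists k', ginv k k'.
Proof.
  intros Hk (Hs & S1 & S2). pose proof (inG_fiter n k Hk) as Hkn.
  set (u := gcomp (fiter n k) s). set (v := gcomp s (fiter n k)).
  assert (Hu : germ_eq (gcomp k u) idC) by exact S1.
  assert (Hv : germ_eq (gcomp v k) idC).
  { transitivity (gcomp s (fiter (S n) k)); [|exact S2].
    apply (germ_eq_comp_l s (gcomp (fiter n k) k)). exists 1. split; [lra|].
    intros z _. symmetry. apply fiter_succ_r. }
  assert (Huv : germ_eq u v).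
  { transitivity (gcomp (gcomp v k) u).
    - symmetry. apply (germ_eq_comp_r (gcomp v k) idC u); auto. apply inG_gcomp; auto.
    - apply (germ_eq_comp_l v (gcomp k u) idC). exact Hu. }
  exists u. split; [apply inG_gcomp; auto|]. split; auto.
  transitivity (gcomp v k); auto. apply germ_eq_comp_r; auto.
Qed.

Lemma germ_eq_inG (f g : C -> C) : inG f -> germ_eq f g -> inG g.
Proof.
  intros Hf H. pose proof Hf as [Hh [H0 Hm]]. repeat split.
  - destruct (near0_and _ _ Hh H) as (r & Hr & Hz). exists r. split; auto.
    intros z Hzr. destruct (Hz z Hzr) as [[l Hl] _]. exists l.
    apply (is_Cderive_ext_loc f g _ _ (r - Cmod z)); auto; [lra|].
    intros w Hw. apply Hz. pose proof (Cmod_tri_inv w z). lra.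
  - destruct H as (r & Hr & Hz). rewrite <- Hz by (rewrite Cmod_0; auto). exact H0.
  - rewrite (germ_eq_multiplier f g); auto.
Qed.

Lemma ginv_germ_eq (f g f' : C -> C) : inG f -> germ_eq f g -> ginv f f' -> ginv g f'.
Proof.
  intros Hf H (Hf' & H1 & H2). split; auto. split.
  - transitivity (gcomp f f'); auto. apply germ_eq_comp_r; auto. symmetry. auto.
  - transitivity (gcomp f' f); auto. apply germ_eq_comp_l. symmetry. auto.
Qed.

Lemma has_order_zp (x : germs) (n : nat) : (0 < n)%nat ->
  (forall a, zp x a == gone <-> (Z.of_nat n | a)%Z) -> has_order (ig x) n.
Proof.
  intros Hn H. assert (Hk : forall k, germ_eq (fiter k (ig x)) idC <-> zp x (Z.of_nat k) == gone).
  { intros k. rewrite zp_of_nat, <- ig_npow. reflexivity. }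
  split; auto. split.
  - apply Hk, H, Z.divide_refl.
  - intros k Hkn E. apply Hk, H, Z.divide_pos_le in E; lia.
Qed.

(** Applied with F' = f, b = 1 to commuting germs and with F' = f^-1, b = -1 to reversers. *)
Lemma multiplier_pow_conj (p : nat) (F F' k : C -> C) (a b : C) :
  a <> RtoC 0 -> inG k -> has_exp p F a -> has_exp p F' (b * a)%C ->
  germ_eq (gcomp F k) (gcomp k F') -> (multiplier k ^ p)%C = b.
Proof.
  intros Ha Hk HF HF' H. pose proof (has_exp_conj p F F' k a (b * a)%C Hk HF HF' H) as E.
  replace (multiplier k ^ p)%C with (multiplier k ^ p * a / a)%C by (field; auto).
  rewrite E. field. auto.
Qed.

Lemma odd_div (a b : nat) (t : Z) :
  (0 < b)%nat -> Z.of_nat a = (Z.of_nat b * t)%Z -> Z.Odd t -> Nat.divide b a /\ Nat.Odd (a / b).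
Proof.
  intros Hb E [k Hk]. assert (Ht : (0 <= t)%Z) by nia.
  assert (Ea : a = (Z.to_nat t * b)%nat) by nia.
  split; [exists (Z.to_nat t); exact Ea|].
  rewrite Ea, Nat.div_mul by lia. exists (Z.to_nat k). lia.
Qed.

Theorem theorem5p1
  (p : nat) (f : C -> C)
  (hp : (1 <= p)%nat)
  (hfA : inAp p f)
  (hrev : exists g, reverser f g)
  (hnf : ~ flowable f)
  (* d and the root f^{1/d} =: h, generator of C_f(G_1) with h^d = f *)
  (d : nat) (h : C -> C)
  (hd : (0 < d)%nat)
  (hh : centG1 f h)
  (hhd : germ_eq (fiter d h) f)
  (hgen : forall k, centG1 f k -> exists n : Z, zpow_rel h n k)
  (* q = index of C_f(G_1) in C_f(G) *)
  (q : nat)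
  (hq : has_index (centG1 f) (centG f) q)
  (* delta = order of the (cyclic) torsion subgroup of C_f(G), omega a generator *)
  (delta : nat) (omega : C -> C)
  (homega : centG f omega)
  (hord : has_order omega delta)
  (htor : forall x, centG f x -> is_torsion x ->
            exists k : nat, germ_eq x (fiter k omega)) :
  (* (1) *)
  (forall g, reverser f g ->
     gcommute g omega /\
     (forall (r : Z) (F : C -> C), zpow_rel h r F -> reverses g F)) /\
  (* (2) *)
  (delta = q /\ Nat.divide q p /\ Nat.Odd (p / q)) /\
  (* (3) *)
  ((multiplier omega = (cos (2 * PI / INR delta), sin (2 * PI / INR delta)) ->
      (forall g, reverser f g ->
         exists l : Z, Z.Odd l /\ zpow_rel omega l (gcomp g g)) /\
      (forall l : Z, Z.Odd l ->
         exists g, reverser f g /\ zpow_rel omega l (gcomp g g))) /\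
   (forall g, reverser f g ->
      exists r : nat, (0 < r)%nat /\ Nat.divide r q /\ Nat.Odd (q / r) /\
        has_order g (2 * r)) /\
   (forall r : nat, (0 < r)%nat -> Nat.divide r q -> Nat.Odd (q / r) ->
      exists g, reverser f g /\ has_order g (2 * r))).
Proof.
  pose proof (proj1 (proj1 (proj1 hfA))) as Hf.
  destruct hrev as [g0 Hg0]. pose proof Hg0 as [_ (g0' & f' & _ & Hf' & _)].
  set (F := IGerm f f' Hf Hf' : germs).
  assert (HhG : inG h) by apply hh.
  assert (Hh : exists h', ginv h h').
  { destruct d as [|d']; [lia|]. apply (ginv_of_fiter d' h f' HhG).
    apply (ginv_germ_eq f); auto. symmetry. exact hhd. }
  destruct Hh as [h' Hh']. set (H := IGerm h h' HhG Hh' : germs).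
  destruct (has_exp_of_inAp p f hp hfA) as (a & Ha & Hexp).
  assert (Hmf : multiplier f = RtoC 1) by apply hfA.
  assert (Hmf' : multiplier f' = RtoC 1).
  { pose proof (germ_eq_multiplier _ _ (inG_gcomp f f' Hf (proj1 Hf')) (proj1 (proj2 Hf'))) as E.
    rewrite (multiplier_gcomp f f' Hf (proj1 Hf')), multiplier_idC, Hmf, Cmult_1_l in E. auto. }
  assert (Hexp' : has_exp p f' (- RtoC 1 * a)%C).
  { replace (- RtoC 1 * a)%C with (- a)%C by ring. apply (has_exp_inv p f f'); auto; apply Hf'. }
  assert (Hcentr : forall k, centG f k -> (multiplier k ^ p)%C = RtoC 1).
  { intros k [Hk Hkf]. apply (multiplier_pow_conj p f f k a); auto.
    - rewrite Cmult_1_l. exact Hexp.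
    - symmetry. exact Hkf. }
  (* k^p has multiplier 1, so [hgen] makes it a power of h; being invertible, it yields an inverse
     of k. *)
  assert (Helt : forall k, centG f k -> exists x : germs, ig x = k /\ twist F 1 x).
  { intros k Hk. pose proof Hk as [HkG Hkf].
    assert (Hp1 : centG1 f (fiter p k)).
    { split; [split; [apply inG_fiter; auto|]|apply gcommute_fiter; auto].
      rewrite multiplier_fiter by auto. apply Hcentr, Hk. }
    destruct (hgen _ Hp1) as [n Hn]. apply (zpow_rel_zp H) in Hn.
    assert (Hinv : exists k', ginv k k').
    { destruct p as [|p']; [lia|]. apply (ginv_of_fiter p' k (igV (zp H n)) HkG).
      apply (ginv_germ_eq (ig (zp H n))); [apply ig_inG|symmetry; exact Hn|apply ig_ginv]. }
    destruct Hinv as [k' Hk']. exists (IGerm k k' HkG Hk' : germs). split; [reflexivity|].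
    apply gcommute_twist. exact Hkf. }
  assert (m_centr : forall x, twist F 1 x -> (germ_mult x ^ p)%C = RtoC 1).
  { intros x Hx. apply Hcentr. split; [apply ig_inG|]. apply (gcommute_twist F). exact Hx. }
  assert (m_rev : forall x, twist F (-1) x -> (germ_mult x ^ p)%C = (- RtoC 1)%C).
  { intros x Hx. apply (multiplier_pow_conj p f f' (ig x) a _ Ha (ig_inG x) Hexp Hexp').
    assert (E : zp F (-1) == gopp F) by (rewrite (zp_opp F 1), zp_1; reflexivity).
    unfold twist in Hx. rewrite E in Hx. exact Hx. }
  (* f^n has the coefficient n a at z^(p+1), while the identity has 0. *)
  assert (Hnp : forall n : nat, npow F n == gone -> n = 0%nat).
  { intros n Hn. assert (Hn' : germ_eq (fiter n f) idC) by (change f with (ig F); rewrite <- (ig_npow F n); exact Hn).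
    pose proof (has_exp_germ _ _ _ _ Hn' (has_exp_fiter p f a n hp Hexp)) as E.
    pose proof (has_exp_unique _ _ _ _ E (has_exp_id p)) as E0.
    destruct n as [|n]; auto. exfalso. revert E0. apply Cmult_neq_0; auto.
    intros E1. apply RtoC_inj in E1. apply (not_0_INR (S n)); auto. }
  assert (F_free : forall n, zp F n == gone -> n = 0%Z).
  { intros n Hn. destruct (Z.abs_or_opp_abs n) as [En|En];
      rewrite <- (Zabs2Nat.id_abs n) in En.
    - rewrite En, zp_of_nat in Hn. apply Hnp in Hn. lia.
    - assert (Hn' : zp F (- n) == gone).
      { rewrite zp_opp, Hn. symmetry. apply gopp_unique, gop1. }
      rewrite En, Z.opp_involutive, zp_of_nat in Hn'. apply Hnp in Hn'. lia. }
  assert (h_root : zp H (Z.of_nat d) == F).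
  { rewrite zp_of_nat. change (germ_eq (ig (npow H d)) f). rewrite ig_npow. exact hhd. }
  assert (h_mult : germ_mult H = RtoC 1) by apply hh.
  assert (h_gen : forall x, twist F 1 x -> germ_mult x = RtoC 1 -> exists n, x == zp H n).
  { intros x Hx Hm. destruct (hgen (ig x)) as [n Hn].
    - split; [split; [apply ig_inG|exact Hm]|]. apply (gcommute_twist F). exact Hx.
    - exists n. apply (zpow_rel_zp H) in Hn. exact Hn. }
  assert (d_pos : (0 < Z.of_nat d)%Z) by lia.
  destruct (cyclic_multipliers germ_mult germ_mult_proper germ_mult_op germ_mult_one
      p F hp m_centr m_rev) as (g & Hg & g_gen).
  { destruct (reverser_igerm F g0 Hg0) as (x & _ & Hx). exists x. exact Hx. }
  destruct (order_of_square germ_mult germ_mult_proper germ_mult_op germ_mult_one p F H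
      (Z.of_nat d) hp m_centr m_rev F_free d_pos h_root h_mult h_gen g Hg) as (N & HN & HNo).
  destruct (Helt omega homega) as (w & <- & Hw).
  destruct hord as (delta_pos & w_delta & w_min).
  assert (Hwk : forall k : nat, zp w (Z.of_nat k) == gone <-> germ_eq (fiter k (ig w)) idC).
  { intros k. rewrite zp_of_nat, <- ig_npow. reflexivity. }
  assert (delta_pos' : (0 < Z.of_nat delta)%Z) by lia.
  assert (w_delta' : zp w (Z.of_nat delta) == gone) by (apply Hwk; exact w_delta).
  assert (w_min' : forall k, (0 < k < Z.of_nat delta)%Z -> ~ zp w k == gone).
  { intros k Hk E. rewrite <- (Z2Nat.id k) in E by lia. apply Hwk in E.
    revert E. apply w_min. lia. }
  assert (w_gen : forall x, twist F 1 x -> (exists n, (0 < n)%Z /\ zp x n == gone) ->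
     exists k, x == zp w k).
  { intros x Hx (n & Hn & E). destruct (htor (ig x)) as [k Hk].
    - split; [apply ig_inG|]. apply (gcommute_twist F). exact Hx.
    - exists (Z.to_nat n). split; [lia|]. rewrite <- (Z2Nat.id n), zp_of_nat in E by lia.
      rewrite <- ig_npow. exact E.
    - exists (Z.of_nat k). rewrite zp_of_nat. rewrite <- ig_npow in Hk. exact Hk. }
  assert (Hq : Z.of_nat q = N).
  { destruct hq as (c & Hc & Hinj & Hsurj).
    assert (Hch : forall i, exists x : germs, (i < q)%nat -> ig x = c i /\ twist F 1 x).
    { intros i. destruct (Nat.lt_ge_cases i q) as [Hi|Hi].
      - destruct (Helt _ (Hc i Hi)) as [x Hx]. exists x. auto.
      - exists F. lia. }
    set (c' := fun i => proj1_sig (constructive_indefinite_description _ (Hch i))).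
    assert (Hc' : forall i, (i < q)%nat -> ig (c' i) = c i /\ twist F 1 (c' i)).
    { intros i. exact (proj2_sig (constructive_indefinite_description _ (Hch i))). }
    apply (index_eq_N germ_mult germ_mult_proper germ_mult_op germ_mult_one p F H
      (Z.of_nat d) hp m_centr m_rev F_free d_pos h_root h_mult h_gen g Hg g_gen N HN HNo q c').
    - intros i Hi. apply Hc'; auto.
    - intros i j Hi Hj (k & Hk & Hmk & E). apply Hinj; auto. exists (ig k). split.
      + split; [split; [apply ig_inG|exact Hmk]|]. apply (gcommute_twist F). exact Hk.
      + rewrite <- (proj1 (Hc' i Hi)), <- (proj1 (Hc' j Hj)). exact E.
    - intros x Hx. destruct (Hsurj (ig x)) as (i & Hi & k & [[Hk Hmk] Hkf] & E).
      + split; [apply ig_inG|]. apply (gcommute_twist F). exact Hx.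
      + exists i. split; auto. destruct (Helt k (conj Hk Hkf)) as (y & <- & Hy).
        exists y. split; auto. split; [exact Hmk|].
        rewrite <- (proj1 (Hc' i Hi)) in E. exact E. }
  split; [|split; [|split; [|split]]].
  - intros x Hx. destruct (reverser_igerm F x Hx) as (y & <- & Hy). split.
    + exact (rev_commutes_omega germ_mult germ_mult_proper germ_mult_op germ_mult_one p F H
        (Z.of_nat d) hp m_centr m_rev F_free d_pos h_root h_mult h_gen g Hg g_gen N HN HNo
        w (Z.of_nat delta) Hw delta_pos' w_delta' y Hy).
    + intros r K HK. apply (zpow_rel_zp H) in HK.
      assert (Hr : twist (zp H r) (-1) y).
      { pose proof (twist_root germ_mult germ_mult_proper germ_mult_op germ_mult_one p F H
          (Z.of_nat d) hp F_free d_pos h_root h_mult h_gen (-1) y eq_refl Hy) as Hy'.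
        unfold twist. rewrite <- zp_mul, Z.mul_comm, zp_mul. apply zp_intertwine. exact Hy'. }
      (* [K] is only germ-equal to h^r; it takes over the inverse of h^r to become a group
         element. *)
      assert (HKG : inG K) by (apply (germ_eq_inG (ig (zp H r))); [apply ig_inG|symmetry; exact HK]).
      assert (HKV : ginv K (igV (zp H r))).
      { apply (ginv_germ_eq (ig (zp H r))); [apply ig_inG|symmetry; exact HK|apply ig_ginv]. }
      apply (reverses_twist (IGerm K _ HKG HKV : germs) y).
      assert (EK : (IGerm K _ HKG HKV : germs) == zp H r) by exact HK.
      unfold twist. rewrite EK. exact Hr.
  - split.
    + apply Nat2Z.inj. rewrite Hq.
      exact (delta_eq_N germ_mult germ_mult_proper germ_mult_op germ_mult_one p F H
        (Z.of_nat d) hp m_centr m_rev F_free d_pos h_root h_mult h_gen g Hg g_gen N HN HNo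
        w (Z.of_nat delta) Hw delta_pos' w_delta' w_min' w_gen).
    + destruct (N_divides_p germ_mult germ_mult_proper germ_mult_op germ_mult_one p F H
        (Z.of_nat d) hp m_centr m_rev F_free d_pos h_root h_mult h_gen g Hg N HNo) as (t & Ht & Hodd).
      apply (odd_div p q t); auto; [lia|]. rewrite Hq. exact Ht.
  - intros _. split.
    + intros x Hx. destruct (reverser_igerm F x Hx) as (y & <- & Hy).
      destruct (rev_square_omega germ_mult germ_mult_proper germ_mult_op germ_mult_one p F H
        (Z.of_nat d) hp m_centr m_rev F_free d_pos h_root h_mult h_gen g Hg g_gen N HN HNo
        w (Z.of_nat delta) Hw delta_pos' w_delta' w_gen y Hy) as (l & Hl & E).
      exists l. split; auto. apply (zpow_rel_zp w). exact E.
    + intros l Hl.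
      destruct (omega_odd_power germ_mult germ_mult_proper germ_mult_op germ_mult_one p F H
        (Z.of_nat d) hp m_centr m_rev F_free d_pos h_root h_mult h_gen g Hg g_gen N HN HNo
        w (Z.of_nat delta) Hw delta_pos' w_delta' w_gen l Hl) as (y & Hy & E).
      exists (ig y). split; [exact (igerm_reverser F y Hy)|]. apply (zpow_rel_zp w). exact E.
  - intros x Hx. destruct (reverser_igerm F x Hx) as (y & <- & Hy).
    destruct (rev_order germ_mult germ_mult_proper germ_mult_op germ_mult_one p F H
      (Z.of_nat d) hp m_centr m_rev F_free d_pos h_root h_mult h_gen g Hg g_gen N HN HNo y Hy)
      as (r & s & Hr & HNr & Hs & Hord).
    exists (Z.to_nat r). split; [lia|].
    destruct (odd_div q (Z.to_nat r) s) as [D1 D2]; auto; [lia| |].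
    + rewrite Hq, HNr, Z2Nat.id by lia. reflexivity.
    + split; auto. split; auto. apply has_order_zp; [lia|]. intros b. rewrite Hord.
      replace (Z.of_nat (2 * Z.to_nat r)) with (2 * r)%Z by lia. reflexivity.
  - intros r Hr [s Hs] [b Hb].
    rewrite Hs, Nat.div_mul in Hb by lia.
    destruct (rev_with_order germ_mult p F hp m_centr m_rev g Hg N HNo (Z.of_nat r) (Z.of_nat s))
      as (y & Hy & Hord).
    + lia.
    + exists (Z.of_nat b). lia.
    + exists (ig y). split; [exact (igerm_reverser F y Hy)|].
      apply has_order_zp; [lia|]. intros c. rewrite Hord.
      replace (Z.of_nat (2 * r)) with (2 * Z.of_nat r)%Z by lia. reflexivity.
Qed.
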